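(* For any centered Gaussian random vector $(X_1,X_2,X_3,X_4)$ (each $X_i$ real-valued with positive variance), $$E[X_1^{4}X_2^{2}X_3^{2}X_4^{2}]\ge E[X_1^{4}]\,E[X_2^{2}]\,E[X_3^{2}]\,E[X_4^{2}],$$ and equality holds if and only if $X_1,X_2,X_3,X_4$ are independent.
   Context: All Gaussian random variables are assumed real-valued and non-degenerate (positive variance). *)

(* Defs.v *)
From HB Require Import structures.
From mathcomp Require Import all_boot all_order all_algebra.
From mathcomp Require Import all_classical all_reals all_analysis.
Set Implicit Arguments. Unset Strict Implicit. Unset Printing Implicit Defensive.
Import Order.TTheory GRing.Theory Num.Theory.
Local Open Scope classical_set_scope.
Local Open Scope ring_scope.

(* Y has the centered normal law N(0, s^2) (standard deviation s > 0). *)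
Definition centered_normal_law d (T : measurableType d) (R : realType)
  (P : probability T R) (Y : T -> R) (s : R) : Prop :=
  0 < s /\ forall A : set R, measurable A -> P (Y @^-1` A) = normal_prob 0 s A.

Definition centered_gaussian_law d (T : measurableType d) (R : realType)
  (P : probability T R) (Y : T -> R) : Prop :=
  (forall A : set R, measurable A -> P (Y @^-1` A) = @dirac _ R (0:R) R A)
  \/ exists s, centered_normal_law P Y s.

Definition centered_gaussian_vector4 d (T : measurableType d) (R : realType)
  (P : probability T R) (X1 X2 X3 X4 : T -> R) : Prop :=
  forall a1 a2 a3 a4 : R,
    centered_gaussian_law P (fun w => a1 * X1 w + a2 * X2 w + a3 * X3 w + a4 * X4 w).

Definition independent4 d (T : measurableType d) (R : realType)
  (P : probability T R) (X1 X2 X3 X4 : T -> R) : Prop :=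
  forall B1 B2 B3 B4 : set R,
    measurable B1 -> measurable B2 -> measurable B3 -> measurable B4 ->
    P (X1 @^-1` B1 `&` X2 @^-1` B2 `&` X3 @^-1` B3 `&` X4 @^-1` B4) =
    (P (X1 @^-1` B1) * P (X2 @^-1` B2) * P (X3 @^-1` B3) * P (X4 @^-1` B4))%E.

(* Main.v *)
Require Import Defs.
From HB Require Import structures.
From mathcomp Require Import all_boot all_order all_algebra.
From mathcomp Require Import all_classical all_reals all_analysis.
From mathcomp Require Import measurable_realfun ring lra.
Set Implicit Arguments. Unset Strict Implicit. Unset Printing Implicit Defensive.
Import Order.TTheory GRing.Theory Num.Theory.
Import numFieldNormedType.Exports.
Local Open Scope classical_set_scope.
Local Open Scope ring_scope.

(** Every linear combination of the [X_i] is a centered Gaussian, so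
    [E (t U + Y)^10 = 945 (E (t U + Y)^2)^5] for all [t]; comparing
    coefficients of [t], one variable after the other, expresses
    [E (X1^4 X2^2 X3^2 X4^2)] through the covariances.  Normalize [X1] to unit
    variance and write [X_i = a_i X1 + Y_i] with [Y_i] uncorrelated with [X1].
    The difference of the two sides is then six times a sum of nonnegative
    terms in the [a_i] and the covariance matrix of [Y], and these terms vanish
    together only if all covariances do.
    That uncorrelated components are independent comes from Fourier analysis:
    [E cos (t X_i + Y + c)] factorizes, and a bounded weight [W] with
    [E (W cos (t Z + c)) = 0] for all [t] and [c] satisfies [E (W 1_B(Z)) = 0]
    for every Borel set [B]; so indicators can replace cosines one coordinate at
    a time. *)

(** * Integration against the normal law *)

(** The covariance matrix may be singular, so there is no joint density to work with; the vector
    enters only through the one-dimensional laws of its linear combinations, Dirac law included.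
    Their tenth moments suffice because [10 = 4 + 2 + 2 + 2], with [945 = 9 * 7 * 5 * 3 * 1]; their
    cosine integrals carry the characteristic function, a free phase [c] standing in for complex
    exponentials.

    Since equality has to be characterized, the terms of [gap] must also reveal when they vanish:
    its scalar term and its three binary forms are strictly definite, whereas [trace_form] and
    [qform3] are only semidefinite and inherit their sign from the covariance matrix of [Y].

    The passage from cosines to indicators averages over a Gaussian random frequency. This produces
    Gaussian bumps around an arbitrary point; powers of a bump are again bumps, and suitable
    polynomials in a bump converge to the indicator of an interval. *)

Section integrable_real.
Context d (T : measurableType d) (R : realType) (m : {measure set T -> \bar R}).
Implicit Types f g : T -> R.

Lemma integrable_realZl f a : m.-integrable setT (EFin \o f) ->
  m.-integrable setT (EFin \o (fun x => a * f x)).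
Proof. exact: integrableZl. Qed.

Lemma integrable_realD f g : m.-integrable setT (EFin \o f) ->
  m.-integrable setT (EFin \o g) ->
  m.-integrable setT (EFin \o (fun x => f x + g x)).
Proof. by move=> fi gi; have := integrableD measurableT fi gi. Qed.

Lemma integrable_realB f g : m.-integrable setT (EFin \o f) ->
  m.-integrable setT (EFin \o g) ->
  m.-integrable setT (EFin \o (fun x => f x - g x)).
Proof. by move=> fi gi; have := integrableB measurableT fi gi. Qed.

End integrable_real.

Section normal_integral.
Context {R : realType}.
Local Notation mu := (@lebesgue_measure R).
Implicit Types (s : R) (f : R -> R).
Local Notation N s := (normal_prob (0 : R) s).

(** Change of variables yields the abstract Radon-Nikodym derivative. It agrees almost everywhere
    with [normal_pdf], because both have the same integral over every measurable set. *)
Lemma ge0_integral_normal_prob s (f : R -> \bar R) :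
  (forall x, 0 <= f x)%E -> measurable_fun [set: R] f ->
  (\int[N s]_x f x = \int[mu]_x (f x * (normal_pdf 0 s x)%:E))%E.
Proof.
move=> f0 mf.
have Ns := normal_prob_dominates (0 : R) s.
rewrite -(Radon_Nikodym_SigmaFinite.change_of_variables Ns)//=.
have mpdf : measurable_fun setT (fun x : R => (normal_pdf 0 s x)%:E).
  by apply/measurable_EFinP; exact: measurable_normal_pdf.
apply: ae_eq_integral => //.
- apply: emeasurable_funM => //.
  exact: measurable_int (Radon_Nikodym_SigmaFinite.f_integrable Ns).
- exact: emeasurable_funM.
apply: ae_eqe_mul2l; apply: integral_ae_eq => //.
  exact: Radon_Nikodym_SigmaFinite.f_integrable.
by move=> E _ mE; rewrite -Radon_Nikodym_SigmaFinite.f_integral.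
Qed.

Lemma integrable_normal_prob s f : measurable_fun setT f ->
  mu.-integrable setT (fun x => (f x * normal_pdf 0 s x)%:E) ->
  (N s).-integrable setT (EFin \o f).
Proof.
move=> mf /integrableP[_ foo]; apply/integrableP; split.
  exact/measurable_EFinP.
rewrite ge0_integral_normal_prob//; last first.
  by apply: measurableT_comp => //; exact/measurable_EFinP.
apply: le_lt_trans foo; rewrite le_eqVlt; apply/orP; left; apply/eqP.
apply: eq_integral => x _ /=.
by rewrite -EFinM normrM (ger0_norm (normal_pdf_ge0 _ _ _)).
Qed.

Lemma integrable_mul_normal_pdf s f : (N s).-integrable setT (EFin \o f) ->
  mu.-integrable setT (fun x => (f x * normal_pdf 0 s x)%:E).
Proof.
move=> /integrableP[mf foo]; apply/integrableP; split.
  apply/measurable_EFinP; apply: measurable_funM; first exact/measurable_EFinP.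
  exact: measurable_normal_pdf.
move: foo; rewrite ge0_integral_normal_prob//; last exact: measurableT_comp.
apply: le_lt_trans; rewrite le_eqVlt; apply/orP; left; apply/eqP.
apply: eq_integral => x _ /=.
by rewrite -EFinM normrM (ger0_norm (normal_pdf_ge0 _ _ _)).
Qed.

Lemma Rintegral_normal_prob s f : (N s).-integrable setT (EFin \o f) ->
  \int[N s]_x f x = \int[mu]_x (f x * normal_pdf 0 s x).
Proof.
move=> intf; congr fine.
have intfp := integrable_mul_normal_pdf intf.
rewrite integralE [RHS]integralE; congr (_ - _)%E.
- rewrite ge0_integral_normal_prob; first last.
  + by apply: measurable_funepos; exact: measurable_int intf.
  + by move=> x; exact: funepos_ge0.
  apply: eq_integral => x _; rewrite !funeposE /=.
  by rewrite -!EFin_max -EFinM maxr_pMl ?normal_pdf_ge0// mul0r.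
- rewrite ge0_integral_normal_prob; first last.
  + by apply: measurable_funeneg; exact: measurable_int intf.
  + by move=> x; exact: funeneg_ge0.
  apply: eq_integral => x _; rewrite !funenegE /=.
  by rewrite -!EFin_max -EFinM maxr_pMl ?normal_pdf_ge0// mul0r mulNr.
Qed.

(** Doubling the standard deviation absorbs the power. The exponents differ by
    [x^2 / (2 s^2) - x^2 / (8 s^2) = x^2 / c] with [c = 8/3 s^2]; with [y = x^2 / c], the bound
    [y^k <= k! e^y] gives [|x|^k <= 1 + c^k y^k <= (1 + c^k k!) e^y]. *)
Lemma normal_pdf_poly_bound s k : 0 < s ->
  exists C, 0 <= C /\
    forall x, `|x| ^+ k * normal_pdf 0 s x <= C * normal_pdf 0 (2 * s) x.
Proof.
move=> s0; have ns0 : s != 0 by rewrite gt_eqF.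
have n2s0 : 2 * s != 0 by rewrite mulf_neq0.
pose c : R := 8 / 3 * s ^+ 2.
have c0 : 0 < c by rewrite /c; have := exprn_gt0 2 s0; lra.
pose K := 1 + c ^+ k * k`!%:R.
have K0 : 0 <= K by rewrite addr_ge0// mulr_ge0 ?exprn_ge0 ?ltW.
have p1 := normal_peak_gt0 ns0; have p2 := normal_peak_gt0 n2s0.
exists (K * normal_peak s / normal_peak (2 * s)); split.
  by apply: divr_ge0; [apply: mulr_ge0 => //|]; exact: ltW.
move=> x; rewrite !normal_pdfE//.
rewrite [leRHS](_ : _ = K * normal_fun 0 (2 * s) x * normal_peak s); last first.
  by field; rewrite lt0r_neq0.
rewrite mulrCA [leRHS]mulrC ler_pM2l//.
pose y := x ^+ 2 / c.
have y0 : 0 <= y by rewrite divr_ge0 ?sqr_ge0 ?ltW.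
have -> : normal_fun 0 (2 * s) x = expR y * normal_fun 0 s x.
  rewrite /normal_fun -expRD; congr expR; rewrite /y /c; field; exact: ns0.
rewrite [leRHS]mulrA ler_pM2r; last exact: expR_gt0.
have xk : `|x| ^+ k <= 1 + (x ^+ 2) ^+ k.
  rewrite -exprM mulnC exprM -normrX -real_normK ?num_real//.
  have := sqr_ge0 (`|x ^+ k| - 1 / 2); rewrite sqrrB; lra.
apply: (le_trans xk).
have -> : x ^+ 2 = c * y by rewrite /y; field; rewrite lt0r_neq0.
rewrite exprMn mulrDl lerD//.
  by rewrite mul1r; have := expR_ge1Dx y; lra.
rewrite -mulrA ler_pM2l ?exprn_gt0//.
case: k @K K0 xk => [|k] K K0 xk.
  by rewrite expr0 fact0 mul1r; have := expR_ge1Dx y; lra.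
have := expR_ge1Dxn k y0.
have kf : 0 < (k.+1)`!%:R :> R by rewrite ltr0n fact_gt0.
move=> h; rewrite mulrC -ler_pdivrMr//; apply: le_trans h.
by rewrite lerDr.
Qed.

Lemma normal_integrable_poly s f k (C : R) : 0 < s -> measurable_fun [set: R] f ->
  (forall x, `|f x| <= C * (1 + `|x| ^+ k)) ->
  (N s).-integrable setT (EFin \o f).
Proof.
move=> s0 mf fC; apply: integrable_normal_prob => //.
have C0 : 0 <= C.
  by have := fC 0; have := normr_ge0 (f 0); case: k {fC} => [|k];
    rewrite normr0 ?expr0 ?expr0n/=; lra.
have [D [D0 hD]] := normal_pdf_poly_bound k s0.
have i1 := integrable_normal_pdf (0:R) s.
have i2 := integrable_normal_pdf (0:R) (2 * s).
have ig : mu.-integrable setT (fun x => C%:E * (normal_pdf 0 s x)%:E +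
   (C * D)%:E * (normal_pdf 0 (2 * s) x)%:E)%E.
  by apply: integrableD => //; exact: integrableZl.
apply: le_integrable ig => //.
  apply/measurable_EFinP; apply: measurable_funM => //.
  exact: measurable_normal_pdf.
move=> x _ /=; rewrite lee_fin normrM.
rewrite (ger0_norm (normal_pdf_ge0 _ _ _)).
rewrite [leRHS]ger0_norm; last first.
  by rewrite addr_ge0 ?mulr_ge0 ?normal_pdf_ge0.
apply: le_trans (ler_wpM2r (normal_pdf_ge0 _ _ _) (fC x)) _.
by rewrite mulrDr mulr1 mulrDl lerD2l -mulrA -mulrA ler_wpM2l.
Qed.

(** The last hypothesis makes [F] decay like [1 / |x|], so the boundary terms of the fundamental
    theorem on growing symmetric intervals tend to 0, while dominated convergence recovers the full
    integral. *)
Lemma Rintegral_derive_eq0 (F f : R -> R) (K : R) :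
  (forall x : R, is_derive x 1 F (f x)) -> continuous f ->
  mu.-integrable setT (EFin \o f) -> (forall x, `|x| * `|F x| <= K) ->
  \int[mu]_x f x = 0.
Proof.
move=> dF cf intf FK.
pose I n : set R := `[(- n.+1%:R : R), (n.+1%:R : R)]%classic.
pose f_ n x := ((f \_ (I n)) x)%:E.
have mf : measurable_fun setT f by exact: continuous_measurable_fun.
have cv : (\int[mu]_x f_ n x @[n --> \oo] --> \int[mu]_x (f x)%:E)%E.
  apply: (@dominated_cvg _ _ _ mu setT measurableT f_ (EFin \o f) (fun x => `|f x|%:E)) => //.
  - move=> n; apply/measurable_EFinP.
    by apply/(measurable_restrictT _ _).1; [exact: measurable_itv|exact: measurable_funTS].
  - move=> x _; apply: cvg_near_cst; near=> n.
    rewrite /f_ patchE mem_set// /I /= in_itv/= -ler_norml.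
    rewrite (@le_trans _ _ n%:R) ?ler_nat//.
    by near: n; exact: nbhs_infty_ger.
  - by move: intf => /integrable_norm; apply.
  - move=> n x _; rewrite /f_ patchE; case: ifPn => _ //=.
    by rewrite normr0 lee_fin.
have cv0 : (\int[mu]_x f_ n x @[n --> \oo] --> 0%:E)%E.
  have -> : (fun n => \int[mu]_x f_ n x)%E =
      (fun n => (F n.+1%:R - F (- n.+1%:R))%:E).
    apply/funext => n; rewrite /f_.
    rewrite (_ : (fun x => _) = (EFin \o f) \_ (I n)); last by rewrite restrict_EFin.
    rewrite -integral_mkcond EFinB /I; apply: continuous_FTC2.
    + by rewrite gtrN// ltr0n.
    + exact: continuous_subspaceT.
    + have cF (x : R) : {for x, continuous F}.
        apply: differentiable_continuous; apply/derivable1_diffP.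
        by have [] := dF x.
      split => [x _| |]; first by have [] := dF x.
        by apply: cvg_at_right_filter; exact: cF.
      by apply: cvg_at_left_filter; exact: cF.
    + by move=> x _; rewrite derive1E; have [_ ->] := dF x.
  apply: cvg_EFin; first exact: nearW.
  rewrite /comp/=.
  apply: norm_cvg0.
  apply: (@squeeze_cvgr _ _ _ _ (cst 0) (fun n => 2 * K * n.+1%:R^-1)).
  - apply: nearW => n; rewrite /= normr_ge0/=.
    rewrite ler_pdivlMr ?ltr0n//.
    apply: le_trans (ler_wpM2r _ (ler_normB _ _)) _; first by rewrite ler0n.
    rewrite mulrDl; have := FK n.+1%:R; have := FK (- n.+1%:R).
    by rewrite normrN (ger0_norm (ler0n _ _)); lra.
  - exact: cvg_cst.
  - rewrite -[X in _ --> X](mulr0 (2 * K)); apply: cvgMr.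
    exact: cvg_harmonic.
by rewrite /Rintegral (cvg_unique _ cv cv0).
Unshelve. all: by end_near. Qed.

End normal_integral.

(** * Stein's identity; moments and characteristic function of the normal law *)

Section normal_stein.
Context {R : realType}.
Local Notation mu := (@lebesgue_measure R).
Local Notation N s := (normal_prob (0 : R) s).
Implicit Types (s : R).

Lemma is_derive_normal_pdf s (x : R) : s != 0 ->
  is_derive x 1 (normal_pdf 0 s) (- (x / s ^+ 2) * normal_pdf 0 s x).
Proof.
move=> s0; rewrite normal_pdfE//.
have h : is_derive x 1 (fun y : R => - (y - 0) ^+ 2 / (s ^+ 2 *+ 2)) (- (x / s ^+ 2)).
  apply: is_derive_eq; rewrite /GRing.scale /= ?subr0 ?expr1; field; exact: s0.
have h2 : is_derive x 1 (normal_fun 0 s) (normal_fun 0 s x * - (x / s ^+ 2)).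
  exact: (@is_derive1_comp _ expR _ x).
have := is_deriveZ (normal_peak s) h2.
by rewrite /GRing.scale /= => h3; apply: is_derive_eq h3 _; ring.
Qed.

(** Integration by parts: [(x * g x - s ^+ 2 * g' x) * normal_pdf 0 s x] is the derivative of
    [- s ^+ 2 * (g x * normal_pdf 0 s x)], which decays fast enough by the growth bound on [g]. *)
Lemma normal_stein s (g g' : R -> R) (C : R) k : 0 < s ->
  (forall x : R, is_derive x 1 g (g' x)) -> continuous g' ->
  (forall x, `|g x| <= C * (1 + `|x| ^+ k)) ->
  (forall x, `|g' x| <= C * (1 + `|x| ^+ k)) ->
  \int[N s]_x (x * g x) = s ^+ 2 * \int[N s]_x g' x.
Proof.
move=> s0 dg cg' gC g'C; have ns0 : s != 0 by rewrite gt_eqF.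
have cg : continuous g.
  move=> x; apply: differentiable_continuous; apply/derivable1_diffP.
  by have [] := dg x.
have mg : measurable_fun setT g by exact: continuous_measurable_fun.
have mg' : measurable_fun setT g' by exact: continuous_measurable_fun.
have C0 : 0 <= C.
  by have := gC 0; have := normr_ge0 (g 0); case: k {gC g'C} => [|k];
    rewrite normr0 ?expr0 ?expr0n/=; lra.
(* The factor 3: [|x| <= 1 + |x|^(k+1)], hence [|x| (1 + |x|^k) <= 1 + 2 |x|^(k+1)]. *)
have xg x : `|x * g x| <= (3 * C) * (1 + `|x| ^+ k.+1).
  rewrite normrM; apply: le_trans (ler_wpM2l (normr_ge0 _) (gC x)) _.
  rewrite mulrCA (mulrC 3) -[leRHS]mulrA ler_wpM2l// mulrDr mulr1 -exprS.
  have : `|x| <= 1 + `|x| ^+ k.+1.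
    have [x1|/ltW x1] := leP `|x| 1.
      by apply: (le_trans x1); rewrite lerDl exprn_ge0.
    by rewrite exprS ler_wpDl// ler_peMr// exprn_ege1.
  have := exprn_ge0 k.+1 (normr_ge0 x); lra.
have i1 : (N s).-integrable setT (EFin \o (fun x => x * g x)).
  apply: (normal_integrable_poly s0 _ xg); exact: measurable_funM.
have i2 : (N s).-integrable setT (EFin \o g').
  exact: (normal_integrable_poly s0 _ g'C).
have i2' : (N s).-integrable setT (EFin \o (fun x => s ^+ 2 * g' x)).
  exact: integrable_realZl.
rewrite -RintegralZl//; apply/eqP; rewrite -subr_eq0 -RintegralB//.
pose F x := - s ^+ 2 * (g x * normal_pdf 0 s x).
pose f x := (x * g x - s ^+ 2 * g' x) * normal_pdf 0 s x.
have i3 : (N s).-integrable setT (EFin \o (fun x => x * g x - s ^+ 2 * g' x)).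
  exact: integrable_realB.
have [D [D0 hD]] := normal_pdf_poly_bound k.+1 s0.
have [E [E0 hE]] := normal_pdf_poly_bound 0 s0.
have ns20 : 2 * s != 0 by rewrite mulf_neq0.
rewrite Rintegral_normal_prob//; apply/eqP.
apply: (@Rintegral_derive_eq0 _ F f (s ^+ 2 * (3 * C) * ((E + D) * normal_peak (2 * s)))).
- move=> x; have h := @is_derive_normal_pdf s x ns0; have h2 := dg x.
  rewrite /F; apply: is_derive_eq; rewrite /GRing.scale /= /f; field; exact: ns0.
- move=> x; apply: cvgM; last exact: continuous_normal_pdf.
  apply: cvgB; apply: cvgM; [exact: cvg_id|exact: cg|exact: cvg_cst|exact: cg'].
- exact: integrable_mul_normal_pdf.
move=> x; rewrite /F normrM normrN (ger0_norm (sqr_ge0 _)) normrM.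
rewrite (ger0_norm (normal_pdf_ge0 _ _ _)) mulrCA -(mulrA (s ^+ 2)) ler_wpM2l ?sqr_ge0//.
rewrite mulrA -normrM.
apply: le_trans (ler_wpM2r (normal_pdf_ge0 _ _ _) (xg x)) _.
rewrite -[leLHS]mulrA; apply: ler_wpM2l; first by rewrite mulr_ge0.
rewrite mulrDl mul1r.
have p1 := normal_pdf_ub 0 x ns20.
have := hE x; rewrite expr0 mul1r => h1; have h2 := hD x.
have h3 : (E + D) * normal_pdf 0 (2 * s) x <= (E + D) * normal_peak (2 * s).
  by rewrite ler_wpM2l// addr_ge0.
by apply: le_trans h3; rewrite mulrDl; exact: lerD.
Qed.

Lemma normal_integrableX s n : 0 < s ->
  (N s).-integrable setT (EFin \o (fun x => x ^+ n)).
Proof.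
move=> s0; apply: (@normal_integrable_poly _ _ _ n 1 s0).
  exact: measurable_funX.
by move=> x; rewrite normrX mul1r lerDr.
Qed.

Lemma normal_moment_rec s n : 0 < s ->
  \int[N s]_x (x ^+ n.+2) = n.+1%:R * s ^+ 2 * \int[N s]_x (x ^+ n).
Proof.
move=> s0.
have -> : (fun x : R => x ^+ n.+2) = (fun x => x * x ^+ n.+1).
  by apply/funext => x; rewrite -exprS.
suff -> : \int[N s]_x (x * x ^+ n.+1) = s ^+ 2 * \int[N s]_x (n.+1%:R * x ^+ n).
  rewrite RintegralZl//; first by rewrite mulrCA mulrA.
  exact: normal_integrableX.
apply: (@normal_stein s _ _ n.+1%:R n.+1 s0).
- move=> x; have := is_deriveX n.+1 (is_derive_id x (1:R)).
  by rewrite exprfctE => h; apply: is_derive_eq h _; rewrite /GRing.scale /= mulr1.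
- by move=> x; apply: cvgM; [exact: cvg_cst|exact: exprn_continuous].
- move=> x; rewrite normrX; have := exprn_ge0 n.+1 (normr_ge0 x) => h.
  rewrite (@le_trans _ _ (1 + `|x| ^+ n.+1)) ?lerDr// ler_peMl ?addr_ge0//.
  by rewrite ler1n.
- move=> x; rewrite normrM normr_nat ler_wpM2l// normrX.
  have [x1|/ltW x1] := leP `|x| 1.
    by rewrite ler_wpDr ?exprn_ge0// exprn_ile1.
  by rewrite exprS ler_wpDl// ler_peMl// exprn_ge0.
Qed.

Lemma normal_mean s : 0 < s -> \int[N s]_x x = 0.
Proof.
move=> s0; have := @normal_stein s (cst 1) (cst 0) 1 0 s0.
rewrite (Rintegral_cst _ measurableT) mul0r mulr0.
under eq_Rintegral do rewrite mulr1.
by apply=> [x|x|x]; [exact: cvg_cst|rewrite normr1 expr0; lra|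
  rewrite normr0 expr0; lra].
Qed.

Lemma normal_moment_even s : 0 < s ->
  [/\ \int[N s]_x (x ^+ 2) = s ^+ 2, \int[N s]_x (x ^+ 4) = 3 * s ^+ 4 &
      \int[N s]_x (x ^+ 10) = 945 * s ^+ 10].
Proof.
move=> s0; rewrite !normal_moment_rec//.
under eq_Rintegral do rewrite expr0.
rewrite (Rintegral_cst _ measurableT) mul1r.
have -> : fine (N s setT) = 1 by rewrite probability_setT.
by split; ring.
Qed.

Lemma normal_cos s t c : 0 < s ->
  \int[N s]_x cos (t * x + c) = cos c * expR (- (s * t) ^+ 2 / 2).
Proof.
move=> s0; have ns0 : s != 0 by rewrite gt_eqF.
(* By Stein's identity, phi' = - s^2 t phi. *)
pose phi (t : R) := \int[N s]_x cos (t * x + c).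
have mcos (a : R) : measurable_fun setT (fun x : R => cos (a * x + c)).
  apply: measurableT_comp.
    by apply: continuous_measurable_fun; exact: continuous_cos.
  by apply: measurable_funD => //; exact: measurable_funM.
have msin (a : R) : measurable_fun setT (fun x : R => sin (a * x + c)).
  apply: measurableT_comp.
    by apply: continuous_measurable_fun; exact: continuous_sin.
  by apply: measurable_funD => //; exact: measurable_funM.
have dl (a : R) (x : R) : is_derive x 1 (fun y : R => a * y + c) a.
  by apply: is_derive_eq; rewrite /GRing.scale /=; ring.
have icos (a : R) : (N s).-integrable setT (EFin \o (fun x => cos (a * x + c))).
  apply: (@normal_integrable_poly _ _ _ 0 1 s0) => // x.
  by rewrite expr0; have := cos_max (a * x + c); lra.
have dphi (a : R) : is_derive a 1 phi (- (s ^+ 2 * a) * phi a).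
  have dcos (u x : R) : is_derive u 1 (fun v : R => cos (v * x + c)) (- sin (u * x + c) * x).
    apply: (@is_derive1_comp _ cos).
    by apply: is_derive_eq; rewrite /GRing.scale /=; ring.
  have Ia : `]a - 1, a + 1[%classic a by rewrite /= in_itv /= gtrBl ltrDl ltr01.
  have iabs : (N s).-integrable setT (EFin \o (fun x : R => `|x|)).
    apply: (@normal_integrable_poly _ _ _ 1 1 s0).
      exact: measurableT_comp.
    by move=> x; rewrite normr_id expr1; lra.
  have p1 (x u : R) : partial1of2 (fun v y : R => cos (v * y + c)) u x = - sin (u * x + c) * x.
    by rewrite partial1of2E; have [_] := dcos u x.
  have bnd (x y : R) : `]a - 1, a + 1[%classic x -> [set: R] y ->
      `|partial1of2 (fun v y : R => cos (v * y + c)) x y| <= `|y|.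
    move=> _ _; rewrite p1 normrM normrN ler_piMl//; exact: sin_max.
  have der (x y : R) : `]a - 1, a + 1[%classic x -> [set: R] y ->
      derivable (fun v : R => cos (v * y + c)) x 1.
    by move=> _ _; have [] := dcos x y.
  have D := derivable_under_integral measurableT Ia (fun x _ => icos x) der
     (fun y => normr_ge0 y) iabs bnd.
  have D' := differentiation_under_integral measurableT Ia (fun x _ => icos x) der
     (fun y => normr_ge0 y) iabs bnd.
  apply: DeriveDef => //; rewrite -derive1E D'.
  under eq_Rintegral do rewrite p1.
  have : \int[N s]_x (x * sin (a * x + c)) = s ^+ 2 * \int[N s]_x (a * cos (a * x + c)).
    apply: (@normal_stein s _ _ (1 + `|a|) 0 s0).
    - move=> x; rewrite mulrC; exact: (@is_derive1_comp _ sin).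
    - move=> x; apply: cvgM; first exact: cvg_cst.
      apply: (cvg_comp _ cos); last exact: continuous_cos.
      by apply: cvgD; [apply: cvgM; [exact: cvg_cst|exact: cvg_id]|exact: cvg_cst].
    - move=> x; rewrite expr0; have := sin_max (a * x + c); have := normr_ge0 a; lra.
    - move=> x; rewrite expr0 normrM.
      have := ler_wpM2l (normr_ge0 a) (cos_max (a * x + c)).
      by have := normr_ge0 a; lra.
  rewrite RintegralZl// => E.
  transitivity (- \int[N s]_x (x * sin (a * x + c))); last by rewrite E /phi; ring.
  rewrite -mulN1r -RintegralZl//.
    by apply: eq_Rintegral => x _; ring.
  apply: (@normal_integrable_poly _ _ _ 1 1 s0).
    exact: measurable_funM.
  move=> x; rewrite expr1 normrM.
  have := ler_wpM2l (normr_ge0 x) (sin_max (a * x + c)); lra.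
(* Integrating factor of the differential equation for [phi]: the product [phi * e] has derivative
   0, so it keeps its value [cos c] at 0. *)
pose e (t : R) := expR ((s * t) ^+ 2 / 2).
have de (a : R) : is_derive a 1 e (e a * (s ^+ 2 * a)).
  apply: (@is_derive1_comp _ expR).
  by apply: is_derive_eq; rewrite /GRing.scale /= ?expr1; field.
have d0 (a : R) : is_derive a 1 (fun t => phi t * e t) 0.
  by apply: is_derive_eq; rewrite /GRing.scale /=; ring.
have := is_derive_0_is_cst t 0 d0.
rewrite /e mulr0 expr0n mul0r expR0 mulr1.
have -> : phi 0 = cos c.
  rewrite /phi; under eq_Rintegral do rewrite mul0r add0r.
  rewrite (Rintegral_cst _ measurableT).
  have -> : fine (N s setT) = 1 by rewrite probability_setT.
  by rewrite mulr1.
by move=> <-; rewrite -mulrA -expRD mulNr addrN expR0 mulr1.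
Qed.

End normal_stein.

(** * The inequality for covariance matrices *)

Section covariance_inequality.
Context {R : realFieldType}.
Implicit Types a b c A B D p q r x y z k : R.

Definition qform3 A B D p q r x y z : R :=
  A * x ^+ 2 + B * y ^+ 2 + D * z ^+ 2 +
  2 * (p * x * y + q * x * z + r * y * z).

(* Isserlis' formula for E(X1^4 X2^2 X3^2 X4^2): the variances are k, B2, B3, B4;
   a, b, c are the covariances of X1 with X2, X3, X4, and d, e, f those of the
   pairs (2, 3), (2, 4), (3, 4). *)
Definition moment4222 k B2 B3 B4 a b c d e f : R :=
  3 * k ^+ 2 * (B2 * B3 * B4 + 2 * (d ^+ 2 * B4 + e ^+ 2 * B3 + f ^+ 2 * B2)
    + 8 * (d * e * f)) +
  12 * k * (a ^+ 2 * (B3 * B4 + 2 * f ^+ 2) + b ^+ 2 * (B2 * B4 + 2 * e ^+ 2)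
    + c ^+ 2 * (B2 * B3 + 2 * d ^+ 2)
    + 4 * (a * b * (d * B4 + 2 * e * f) + a * c * (e * B3 + 2 * d * f)
    + b * c * (f * B2 + 2 * d * e))) +
  24 * (a ^+ 2 * b ^+ 2 * B4 + a ^+ 2 * c ^+ 2 * B3 + b ^+ 2 * c ^+ 2 * B2) +
  96 * (a * b * c * (a * f + b * e + c * d)).

(* The variance of a Y3 Y4 + b Y2 Y4 + c Y2 Y3 for a centered Gaussian vector
   (Y2, Y3, Y4) with covariance matrix C = [[A, p, q], [p, B, r], [q, r, D]].
   It equals tr(SCSC)/2, where S is symmetric with zero diagonal and
   off-diagonal entries c, b, a. *)
Definition trace_form A B D p q r a b c : R :=
  a ^+ 2 * (B * D + r ^+ 2) + b ^+ 2 * (A * D + q ^+ 2) +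
  c ^+ 2 * (A * B + p ^+ 2) + 2 * (a * b * (p * D + q * r) +
  a * c * (q * B + p * r) + b * c * (r * A + p * q)).

Lemma psd3_diag_ge0 A B D p q r :
  (forall x y z, 0 <= qform3 A B D p q r x y z) -> [/\ 0 <= A, 0 <= B & 0 <= D].
Proof.
move=> h; have := h 1 0 0; have := h 0 1 0; have := h 0 0 1.
by rewrite /qform3 => h1 h2 h3; split; lra.
Qed.

(** With [A = 0] the form is affine in [x] for fixed [y] and [z]; a nonzero slope lets [x] be solved
    so that the form takes the value -1. *)
Lemma psd3_offdiag0 A B D p q r :
  (forall x y z, 0 <= qform3 A B D p q r x y z) -> A = 0 -> p = 0 /\ q = 0.
Proof.
move=> h A0; split; apply/eqP; apply: contraT => n0.
- have := h (- (B + 1) / (2 * p)) 1 0.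
  rewrite /qform3 A0 (_ : _ + _ = - 1); last by field.
  by rewrite ler0N1.
- have := h (- (D + 1) / (2 * q)) 0 1.
  rewrite /qform3 A0 (_ : _ + _ = - 1); last by field.
  by rewrite ler0N1.
Qed.

Lemma trace_form_ge0 A B D p q r a b c :
  (forall x y z, 0 <= qform3 A B D p q r x y z) ->
  0 <= trace_form A B D p q r a b c.
Proof.
move=> h; have [A0 B0 D0] := psd3_diag_ge0 h.
have [A0'|A0'] := eqVneq A 0.
  have [p0 q0] := psd3_offdiag0 h A0'.
  rewrite /trace_form A0' p0 q0.
  have := mulr_ge0 B0 D0; have := sqr_ge0 a; have := sqr_ge0 r; nra.
have {A0'}A0 : 0 < A by rewrite lt_neqAle eq_sym A0'.
(* Schur complement of the entry A. *)
pose B' := B - p ^+ 2 / A; pose D' := D - q ^+ 2 / A; pose r' := r - p * q / A.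
have h' y z : 0 <= B' * y ^+ 2 + D' * z ^+ 2 + 2 * (r' * y * z).
  have := h (- (p * y + q * z) / A) y z.
  congr (_ <= _); rewrite /qform3 /B' /D' /r'; field; exact: lt0r_neq0.
have B'0 : 0 <= B' by have := h' 1 0; lra.
have D'0 : 0 <= D' by have := h' 0 1; lra.
(* Write [Y3 = (p/A) Y2 + Y3'] and [Y4 = (q/A) Y2 + Y4'] with [Y3'], [Y4'] uncorrelated with [Y2].
   The products then split into a multiple of [Y2^2], a term [Y2 (.. Y3' + .. Y4')] and [a Y3' Y4'];
   these are mutually uncorrelated, and the three summands are their variances. *)
have -> : trace_form A B D p q r a b c =
    2 * ((c * A * p + b * A * q + a * p * q) / A) ^+ 2 +
    (B' * (c * A + a * q) ^+ 2 + D' * (b * A + a * p) ^+ 2 +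
     2 * (r' * (c * A + a * q) * (b * A + a * p))) / A +
    a ^+ 2 * (B' * D' + r' ^+ 2).
  rewrite /trace_form /B' /D' /r'; field; exact: lt0r_neq0.
have e1 := sqr_ge0 ((c * A * p + b * A * q + a * p * q) / A).
have e2 := divr_ge0 (h' (c * A + a * q) (b * A + a * p)) (ltW A0).
have e3 := mulr_ge0 (sqr_ge0 a) (addr_ge0 (mulr_ge0 B'0 D'0) (sqr_ge0 r')).
by rewrite addr_ge0// addr_ge0// mulr_ge0.
Qed.

(* With w = a r + b q + c p, the second term is a positive definite form in
   (w, abc).  The remaining terms come from a positive definite form in the six
   vectors r y2, q y3, p y4, bc y2, ac y3, ab y4 of a Gram representation of
   (Y2, Y3, Y4), invariant under permutations of the indices: a part acting on
   each pair (r y2, bc y2), ... separately, and a part acting on the two sums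
   r y2 + q y3 + p y4 and bc y2 + ac y3 + ab y4. *)
Definition gap A B D p q r a b c : R :=
  2 * trace_form A B D p q r a b c +
  (3 * (a * r + b * q + c * p) ^+ 2
   + 40 * (a * b * c) * (a * r + b * q + c * p) + 157 * (a * b * c) ^+ 2) +
  (r ^+ 2 / 3 + r * (b * c) + 2 * (b * c) ^+ 2) * A +
  (q ^+ 2 / 3 + q * (a * c) + 2 * (a * c) ^+ 2) * B +
  (p ^+ 2 / 3 + p * (a * b) + 2 * (a * b) ^+ 2) * D +
  (2 / 3 * qform3 A B D p q r (r + 15 / 4 * (b * c)) (q + 15 / 4 * (a * c))
     (p + 15 / 4 * (a * b)) +
   45 / 8 * qform3 A B D p q r (b * c) (a * c) (a * b)).

(** The parameters describe [X1 = k G] and [X_i = a_i G + Y_i], where [G] is standard, [a], [b], [c]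
    are the [a_i], and [A], [B], [D], [p], [q], [r] the covariances of [Y]. The factor [3 * k ^+ 4]
    is the fourth moment of [X1]. *)
Lemma moment4222_gap A B D p q r a b c k :
  moment4222 (k ^+ 2) (a ^+ 2 + A) (b ^+ 2 + B) (c ^+ 2 + D)
    (k * a) (k * b) (k * c) (a * b + p) (a * c + q) (b * c + r) =
  3 * k ^+ 4 * ((a ^+ 2 + A) * (b ^+ 2 + B) * (c ^+ 2 + D)) +
  6 * k ^+ 4 * gap A B D p q r a b c.
Proof. by rewrite /moment4222 /gap /trace_form /qform3; field. Qed.

Lemma binary_form_ge0 x y : 0 <= x ^+ 2 / 3 + x * y + 2 * y ^+ 2.
Proof. have := sqr_ge0 (x / 3 + y / 2); have := sqr_ge0 x; have := sqr_ge0 y; nra. Qed.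

Lemma binary_form_eq0 x y : x ^+ 2 / 3 + x * y + 2 * y ^+ 2 = 0 -> x = 0 /\ y = 0.
Proof.
move=> h; have e : x ^+ 2 / 3 + x * y + 2 * y ^+ 2 =
  3^-1 * (x + 3 / 2 * y) ^+ 2 + 5 / 4 * y ^+ 2 by field.
have y2 : y ^+ 2 = 0.
  have := sqr_ge0 (x + 3 / 2 * y); have := sqr_ge0 y; lra.
have y0 : y = 0 by move/eqP: y2; rewrite sqrf_eq0 => /eqP.
split => //; apply/eqP; rewrite -sqrf_eq0; apply/eqP.
by move: h; rewrite y0; lra.
Qed.

Section gap.
Variables A B D p q r a b c : R.
Hypothesis psd : forall x y z, 0 <= qform3 A B D p q r x y z.

Let scalar_term_ge0 :
  0 <= 3 * (a * r + b * q + c * p) ^+ 2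
   + 40 * (a * b * c) * (a * r + b * q + c * p) + 157 * (a * b * c) ^+ 2.
Proof.
set w := a * r + _ + _; set t := a * b * c.
have -> : 3 * w ^+ 2 + 40 * t * w + 157 * t ^+ 2 =
  3 * (w + 20 / 3 * t) ^+ 2 + 71 / 3 * t ^+ 2 by field.
have := sqr_ge0 (w + 20 / 3 * t); have := sqr_ge0 t; lra.
Qed.

Lemma gap_ge0 : 0 <= gap A B D p q r a b c.
Proof.
have [A0 B0 D0] := psd3_diag_ge0 psd.
have t1 := trace_form_ge0 a b c psd.
have t2 := scalar_term_ge0.
have t3 := mulr_ge0 (binary_form_ge0 r (b * c)) A0.
have t4 := mulr_ge0 (binary_form_ge0 q (a * c)) B0.
have t5 := mulr_ge0 (binary_form_ge0 p (a * b)) D0.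
have t6 := psd (r + 15 / 4 * (b * c)) (q + 15 / 4 * (a * c)) (p + 15 / 4 * (a * b)).
have t7 := psd (b * c) (a * c) (a * b).
by rewrite /gap; lra.
Qed.

(** Each nonnegative term is zero. The scalar term forces [a * b * c = 0]. If, say, [c = 0], then
    [D > 0], so the binary form weighted by [D] vanishes and gives [a * b = 0]; hence all pairwise
    products vanish and [trace_form] loses its cross terms. Now [a != 0] would give [b = c = 0], so
    [B * D > 0], against the vanishing of [a^2 (B D + r^2)]. Once [a = b = c = 0], all of [A], [B],
    [D] are positive and the binary forms kill [p], [q], [r]. *)
Lemma gap_eq0 : 0 < a ^+ 2 + A -> 0 < b ^+ 2 + B -> 0 < c ^+ 2 + D ->
  gap A B D p q r a b c = 0 -> [/\ a = 0, b = 0, c = 0, p = 0 & q = 0 /\ r = 0].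
Proof.
move=> hA hB hD g0.
have [A0 B0 D0] := psd3_diag_ge0 psd.
have t1 := trace_form_ge0 a b c psd.
have t2 := scalar_term_ge0.
have t3 := mulr_ge0 (binary_form_ge0 r (b * c)) A0.
have t4 := mulr_ge0 (binary_form_ge0 q (a * c)) B0.
have t5 := mulr_ge0 (binary_form_ge0 p (a * b)) D0.
have t6 := psd (r + 15 / 4 * (b * c)) (q + 15 / 4 * (a * c)) (p + 15 / 4 * (a * b)).
have t7 := psd (b * c) (a * c) (a * b).
move: g0; rewrite /gap => g0.
have s1 : trace_form A B D p q r a b c = 0 by lra.
have s3 : (r ^+ 2 / 3 + r * (b * c) + 2 * (b * c) ^+ 2) * A = 0 by lra.
have s4 : (q ^+ 2 / 3 + q * (a * c) + 2 * (a * c) ^+ 2) * B = 0 by lra.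
have s5 : (p ^+ 2 / 3 + p * (a * b) + 2 * (a * b) ^+ 2) * D = 0 by lra.
have s2 : 3 * (a * r + b * q + c * p) ^+ 2
   + 40 * (a * b * c) * (a * r + b * q + c * p) + 157 * (a * b * c) ^+ 2 = 0 by lra.
have abc0 : a * b * c = 0.
  apply/eqP; rewrite -sqrf_eq0; apply/eqP.
  have := sqr_ge0 (a * r + b * q + c * p + 20 / 3 * (a * b * c)).
  have := sqr_ge0 (a * b * c); nra.
have key x y z X Y : z = 0 -> 0 < z ^+ 2 + Y ->
    (X ^+ 2 / 3 + X * (x * y) + 2 * (x * y) ^+ 2) * Y = 0 -> X = 0 /\ x * y = 0.
  move=> -> Y0 /eqP; rewrite mulf_eq0 => /orP[/eqP /binary_form_eq0 //|/eqP Y1].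
  by move: Y0; rewrite Y1 expr0n addr0 ltxx.
have ab0 : a * b = 0.
  move/eqP: abc0; rewrite mulf_eq0 => /orP[/eqP//|/eqP c0].
  by have [] := key _ _ _ _ _ c0 hD s5.
have ac0 : a * c = 0.
  move/eqP: abc0; rewrite mulrAC mulf_eq0 => /orP[/eqP//|/eqP b0].
  by have [] := key _ _ _ _ _ b0 hB s4.
have bc0 : b * c = 0.
  move/eqP: abc0; rewrite -mulrA mulf_eq0 => /orP[/eqP a0|/eqP//].
  by have [] := key _ _ _ _ _ a0 hA s3.
have s1' : a ^+ 2 * (B * D + r ^+ 2) + b ^+ 2 * (A * D + q ^+ 2) +
    c ^+ 2 * (A * B + p ^+ 2) = 0.
  by move: s1; rewrite /trace_form ab0 ac0 bc0; lra.
have pos x X Y Z : 0 <= X -> 0 <= Y -> 0 <= x ^+ 2 * (X * Y + Z ^+ 2).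
  by move=> X0 Y0; rewrite mulr_ge0 ?sqr_ge0// addr_ge0 ?sqr_ge0// mulr_ge0.
have u1 := pos a _ _ r B0 D0; have u2 := pos b _ _ q A0 D0.
have u3 := pos c _ _ p A0 B0.
have zero x y z X Y Z : x * y = 0 -> x * z = 0 -> 0 < y ^+ 2 + X -> 0 < z ^+ 2 + Y ->
    x ^+ 2 * (X * Y + Z ^+ 2) = 0 -> x = 0.
  move=> xy xz X0 Y0 /eqP; rewrite mulf_eq0 sqrf_eq0 => /orP[/eqP//|].
  have [//|x0] := eqVneq x 0.
  move/eqP: xy; rewrite mulf_eq0 (negbTE x0) => /eqP y0.
  move/eqP: xz; rewrite mulf_eq0 (negbTE x0) => /eqP z0.
  move: X0 Y0; rewrite y0 z0 !expr0n !add0r => X0 Y0.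
  have := mulr_gt0 X0 Y0; have := sqr_ge0 Z => h1 h2 /eqP h3; lra.
have a0 : a = 0 by apply: (zero _ _ _ _ _ r ab0 ac0 hB hD); lra.
have b0 : b = 0.
  by apply: (zero b a c _ _ q _ bc0 hA hD); [rewrite mulrC|lra].
have c0 : c = 0.
  by apply: (zero c a b _ _ p _ _ hA hB); [rewrite mulrC|rewrite mulrC|lra].
split => //; first by have [] := key _ _ _ _ _ c0 hD s5.
by split; [have [] := key _ _ _ _ _ b0 hB s4|have [] := key _ _ _ _ _ a0 hA s3].
Qed.

End gap.

Section moment4222_bound.
Variables k B2 B3 B4 a b c d e f : R.
Hypothesis k0 : 0 < k.
Hypothesis psd : forall w x y z,
  0 <= k ^+ 2 * w ^+ 2 + 2 * w * (a * x + b * y + c * z) +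
       qform3 B2 B3 B4 d e f x y z.

(** The residual covariance matrix after projecting on [X1]: for fixed [x], [y], [z] the full form
    is minimal at [w = - (a x + b y + c z) / k^2]. *)
Let schur x y z : 0 <= qform3 (B2 - (a / k) ^+ 2) (B3 - (b / k) ^+ 2)
  (B4 - (c / k) ^+ 2) (d - a / k * (b / k)) (e - a / k * (c / k))
  (f - b / k * (c / k)) x y z.
Proof.
have := psd (- (a * x + b * y + c * z) / k ^+ 2) x y z.
congr (_ <= _); rewrite /qform3; field; exact: lt0r_neq0.
Qed.

Let moment4222E : moment4222 (k ^+ 2) B2 B3 B4 a b c d e f =
  3 * k ^+ 4 * (B2 * B3 * B4) +
  6 * k ^+ 4 * gap (B2 - (a / k) ^+ 2) (B3 - (b / k) ^+ 2)
  (B4 - (c / k) ^+ 2) (d - a / k * (b / k)) (e - a / k * (c / k))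
  (f - b / k * (c / k)) (a / k) (b / k) (c / k).
Proof.
have kx x : k * (x / k) = x by rewrite mulrC divfK// gt_eqF.
have := moment4222_gap (B2 - (a / k) ^+ 2) (B3 - (b / k) ^+ 2)
  (B4 - (c / k) ^+ 2) (d - a / k * (b / k)) (e - a / k * (c / k))
  (f - b / k * (c / k)) (a / k) (b / k) (c / k) k.
by rewrite !kx !subrKC.
Qed.

Lemma moment4222_ge : 3 * k ^+ 4 * (B2 * B3 * B4) <=
  moment4222 (k ^+ 2) B2 B3 B4 a b c d e f.
Proof.
rewrite moment4222E lerDl; apply: mulr_ge0; last exact: gap_ge0 schur.
by rewrite mulr_ge0// exprn_ge0// ltW.
Qed.

Lemma moment4222_eq : 0 < B2 -> 0 < B3 -> 0 < B4 ->
  moment4222 (k ^+ 2) B2 B3 B4 a b c d e f = 3 * k ^+ 4 * (B2 * B3 * B4) ->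
  [/\ a = 0, b = 0 & c = 0] /\ [/\ d = 0, e = 0 & f = 0].
Proof.
move=> h2 h3 h4; rewrite moment4222E -[RHS]addr0 => /addrI/eqP.
have k4 : 6 * k ^+ 4 != 0 by rewrite mulf_neq0// expf_neq0// gt_eqF.
rewrite mulf_eq0 (negbTE k4)/= => /eqP.
have kx x : x / k = 0 -> x = 0.
  by move=> /eqP; rewrite mulf_eq0 invr_eq0 (gt_eqF k0) orbF => /eqP.
case/(gap_eq0 schur); rewrite ?subrKC// => /kx-> /kx-> /kx->.
by rewrite !mul0r !subr0 => -> [-> ->].
Qed.

Lemma moment4222_diag : moment4222 (k ^+ 2) B2 B3 B4 0 0 0 0 0 0 =
  3 * k ^+ 4 * (B2 * B3 * B4).
Proof. by rewrite /moment4222; ring. Qed.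

End moment4222_bound.

End covariance_inequality.

(** * Mixed moments of Gaussian vectors *)

Section moments.
Context d (T : measurableType d) (R : realType) (P : probability T R).
Implicit Types (f g U V W X Y Z : T -> R).

(** Asking for all powers makes the class closed under products, by [|f g|^n <= f^(2n) + g^(2n)], so
    every mixed moment is integrable at once. *)
Definition has_moments f := measurable_fun setT f /\
  forall n, P.-integrable setT (EFin \o (fun w => f w ^+ n)).

Lemma has_moments_integrable f : has_moments f -> P.-integrable setT (EFin \o f).
Proof. by move=> [_ /(_ 1)]. Qed.

Lemma has_moments_cst (c : R) : has_moments (cst c).
Proof.
split=> [|n]; first exact: measurable_cst.
have : P.-integrable setT (EFin \o cst (c ^+ n)) by apply: finite_measure_integrable_cst.
exact.
Qed.

Lemma has_momentsM f g : has_moments f -> has_moments g ->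
  has_moments (fun w => f w * g w).
Proof.
move=> [mf fi] [mg gi]; have mfg : measurable_fun setT (fun w => f w * g w).
  exact: measurable_funM.
split=> // n; have i := integrable_realD (fi (n * 2)%N) (gi (n * 2)%N).
apply: le_integrable i => //.
  by apply/measurable_EFinP; exact: measurable_funX.
move=> w _; rewrite /= lee_fin !exprM exprMn normrM [leRHS]ger0_norm; last first.
  by rewrite addr_ge0 ?sqr_ge0.
rewrite -[X in _ <= X + _]real_normK ?num_real// -[X in _ <= _ + X]real_normK ?num_real//.
set x := `|f w ^+ n|; set y := `|g w ^+ n|.
have := sqr_ge0 (x - y); have := sqr_ge0 (x + y); nra.
Qed.

Lemma has_momentsX f n : has_moments f -> has_moments (fun w => f w ^+ n).
Proof.
move=> [mf fi]; split; first exact: measurable_funX.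
by move=> k; have := fi (n * k)%N; under eq_fun do rewrite exprM.
Qed.

Lemma Rintegral_sum_ord n (F : nat -> T -> R) :
  (forall i, P.-integrable setT (EFin \o F i)) ->
  P.-integrable setT (EFin \o (fun w => \sum_(i < n) F i w)) /\
  \int[P]_w (\sum_(i < n) F i w) = \sum_(i < n) \int[P]_w F i w.
Proof.
move=> Fi; elim: n => [|n [IHi IHe]].
  split; last by rewrite big_ord0; under eq_Rintegral do rewrite big_ord0;
    rewrite (Rintegral_cst _ measurableT) mul0r.
  rewrite (_ : _ \o _ = cst 0%E); first exact: integrable0.
  by apply/funext => w /=; rewrite big_ord0.
rewrite (_ : (fun w => \sum_(i < n.+1) F i w) = (fun w => \sum_(i < n) F i w + F n w)).
  split; first exact: integrable_realD.
  by rewrite RintegralD// IHe big_ord_recr.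
by apply/funext => w; rewrite big_ord_recr.
Qed.

(** Turns a moment into a polynomial in [t] whose coefficients are mixed moments. The weight [W]
    holds the powers of the variables already extracted. *)
Lemma Rintegral_binomial n W U Y t :
  has_moments W -> has_moments U -> has_moments Y ->
  \int[P]_w (W w * (t * U w + Y w) ^+ n) =
  \sum_(i < n.+1) ('C(n, i)%:R * \int[P]_w (W w * (U w ^+ i * Y w ^+ (n - i)))) * t ^+ i.
Proof.
move=> mW mU mY.
pose F i w := ('C(n, i)%:R * t ^+ i) * (W w * (U w ^+ i * Y w ^+ (n - i))).
have mF i : P.-integrable setT (EFin \o (fun w => W w * (U w ^+ i * Y w ^+ (n - i)))).
  apply: has_moments_integrable; apply: has_momentsM => //.
  by apply: has_momentsM; exact: has_momentsX.
have Fi i : P.-integrable setT (EFin \o F i) by exact: integrable_realZl.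
have [_] := Rintegral_sum_ord n.+1 Fi.
rewrite (_ : (fun w => \sum_(i < n.+1) F i w) =
             (fun w => W w * (t * U w + Y w) ^+ n)); last first.
  apply/funext => w; rewrite addrC exprDn mulr_sumr; apply: eq_bigr => i _.
  by rewrite /F exprMn -mulr_natl; ring.
move=> ->; apply: eq_bigr => i _.
by rewrite RintegralZl// mulrAC.
Qed.

Lemma Rintegral_linear W U Y t : has_moments W -> has_moments U -> has_moments Y ->
  \int[P]_w (W w * (t * U w + Y w)) = \int[P]_w (W w * U w) * t + \int[P]_w (W w * Y w).
Proof.
move=> mW mU mY; have := @Rintegral_binomial 1 W U Y t mW mU mY.
rewrite 2!big_ord_recl big_ord0 /= !bin0 bin1 !mul1r expr0 mulr1 addr0 expr1 addrC.
under eq_Rintegral do rewrite expr1.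
move=> ->; congr (_ * _ + _); apply: eq_Rintegral => w _.
  by rewrite expr0 mulr1 expr1.
by rewrite expr0 mul1r expr1.
Qed.

Lemma Rintegral_square U Y t : has_moments U -> has_moments Y ->
  \int[P]_w ((t * U w + Y w) ^+ 2) = \int[P]_w (U w ^+ 2) * t ^+ 2 +
  2 * \int[P]_w (U w * Y w) * t + \int[P]_w (Y w ^+ 2).
Proof.
move=> mU mY; have m1 : has_moments (cst 1) := has_moments_cst 1.
have := @Rintegral_binomial 2 (cst 1) U Y t m1 mU mY.
under eq_Rintegral do rewrite mul1r.
rewrite 3!big_ord_recl big_ord0 /= /bump /=.
have -> : \int[P]_w (1 * (U w ^+ 0 * Y w ^+ (2 - 0))) = \int[P]_w (Y w ^+ 2).
  by apply: eq_Rintegral => w _; rewrite expr0 !mul1r.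
have -> : \int[P]_w (1 * (U w ^+ (1 + 0) * Y w ^+ (2 - (1 + 0)))) = \int[P]_w (U w * Y w).
  by apply: eq_Rintegral => w _; rewrite !expr1 mul1r.
have -> : \int[P]_w (1 * (U w ^+ (1 + (1 + 0)) * Y w ^+ (2 - (1 + (1 + 0))))) =
          \int[P]_w (U w ^+ 2).
  by apply: eq_Rintegral => w _; rewrite expr0 mul1r mulr1.
by move=> ->; rewrite (_ : 'C(2, 0) = 1)%N// (_ : 'C(2, 1 + 0) = 2)%N//
   (_ : 'C(2, 1 + (1 + 0)) = 1)%N//; ring.
Qed.

(** The difference has degree below [n] but vanishes at the [n] distinct points [0, ..., n-1]. *)
Lemma polynomial_fun_inj n (c e : nat -> R) :
  (forall t : R, \sum_(i < n) c i * t ^+ i = \sum_(i < n) e i * t ^+ i) ->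
  forall i, (i < n)%N -> c i = e i.
Proof.
move=> h i ni; pose q := \poly_(i < n) (c i - e i).
suff q0 : q = 0.
  apply/eqP; rewrite -subr_eq0; apply/eqP.
  by have := congr1 (fun p : {poly R} => p`_i) q0; rewrite coef_poly ni coef0.
apply/eqP; apply: contraT => qn0.
pose s := [seq (k%:R : R) | k <- iota 0 n].
have us : uniq s by rewrite map_inj_uniq ?iota_uniq// => x y /eqP; rewrite eqr_nat => /eqP.
have rs : all (root q) s.
  apply/allP => x _; apply/eqP; rewrite horner_poly.
  under eq_bigr do rewrite mulrBl.
  by rewrite sumrB h subrr.
have := max_poly_roots qn0 rs us.
by rewrite size_map size_iota ltnNge size_poly.
Qed.

Lemma law_transfer (nu : {measure set (measurableTypeR R) -> \bar R}) Y (f : R -> R) :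
  measurable_fun setT Y -> (forall A : set R, measurable A -> P (Y @^-1` A) = nu A) ->
  measurable_fun setT f -> nu.-integrable setT (EFin \o f) ->
  P.-integrable setT (EFin \o (f \o Y)) /\ \int[P]_w f (Y w) = \int[nu]_x f x.
Proof.
move=> mY hY mf /integrableP[_ fi].
have mEf : measurable_fun setT (EFin \o f) by exact/measurable_EFinP.
(* R and measurableTypeR R carry the same sigma-algebra under two displays. *)
have mY' : @measurable_fun _ _ T (measurableTypeR R) setT Y by exact: mY.
pose Y' : {RV P >-> measurableTypeR R} :=
  @mfun_Sub _ _ T (measurableTypeR R) _ (mem_set mY').
have nuE (h : R -> \bar R) : (\int[distribution P Y']_x h x = \int[nu]_x h x)%E.
  by apply: eq_measure_integral => A mA _; exact: hY.
have i : P.-integrable setT (EFin \o (f \o Y)).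
  apply/integrableP; split; first by apply/measurable_EFinP; exact: measurableT_comp.
  rewrite -nuE (@ge0_integral_distribution _ _ _ _ _ P Y') in fi => //.
  exact: measurableT_comp.
split => //; rewrite /Rintegral -nuE.
by rewrite (@integral_distribution _ _ _ _ _ P Y').
Qed.

(** Stated through a variance [v] that may be 0, so that degenerate linear combinations and genuine
    normal laws are treated alike from here on. *)
Lemma gaussian_law_stats Y : measurable_fun setT Y -> centered_gaussian_law P Y ->
  has_moments Y /\ exists v, [/\ 0 <= v, \int[P]_w (Y w ^+ 2) = v,
    \int[P]_w (Y w ^+ 10) = 945 * v ^+ 5 &
    forall c, \int[P]_w cos (Y w + c) = cos c * expR (- v / 2)].
Proof.
move=> mY.
have mX n : measurable_fun setT (fun x : R => x ^+ n) by exact: measurable_funX.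
have mcos c : measurable_fun setT (fun x : R => cos (x + c)).
  apply: measurableT_comp; last exact: measurable_funD.
  by apply: continuous_measurable_fun; exact: continuous_cos.
case=> [hY|[s [s0 hY]]].
  have tr (f : R -> R) : measurable_fun setT f ->
      P.-integrable setT (EFin \o (f \o Y)) /\ \int[P]_w f (Y w) = f 0.
    move=> mf; have [|-> ->] := @law_transfer (@dirac _ (measurableTypeR R) 0 R) Y f mY hY mf.
      apply/integrableP; split; first exact/measurable_EFinP.
      rewrite integral_dirac//=; last by apply/measurable_EFinP; exact: measurableT_comp.
      by rewrite diracT mul1e ltry.
    split => //; rewrite /Rintegral integral_dirac//; last exact/measurable_EFinP.
    by rewrite diracT mul1e.
  split; first by split => // n; have [] := tr _ (mX n).
  exists 0; split => //.
  - by rewrite (tr _ (mX 2)).2 expr0n.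
  - by rewrite (tr _ (mX 10)).2 !expr0n mulr0.
  - by move=> c; rewrite (tr _ (mcos c)).2 add0r oppr0 mul0r expR0 mulr1.
have tr (f : R -> R) : measurable_fun setT f ->
    (normal_prob 0 s).-integrable setT (EFin \o f) ->
    P.-integrable setT (EFin \o (f \o Y)) /\
    \int[P]_w f (Y w) = \int[normal_prob 0 s]_x f x.
  by move=> mf fi; exact: law_transfer.
split; first by split => // n; have [] := tr _ (mX n) (normal_integrableX n s0).
have [h2 h4 h10] := normal_moment_even s0.
exists (s ^+ 2); split => //.
- by rewrite sqr_ge0.
- by rewrite (tr _ (mX 2) (normal_integrableX 2 s0)).2.
- by rewrite (tr _ (mX 10) (normal_integrableX 10 s0)).2 h10 -exprM.
- move=> c; have ic : (normal_prob 0 s).-integrable setT (EFin \o (fun x => cos (x + c))).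
    apply: (@normal_integrable_poly _ _ _ 0 1 s0) => // x.
    by rewrite expr0; have := cos_max (x + c); lra.
  rewrite (tr _ (mcos c) ic).2.
  have := normal_cos 1 c s0; under eq_Rintegral do rewrite mul1r.
  by rewrite mulr1.
Qed.

Lemma gaussian_moment10 Y : measurable_fun setT Y -> centered_gaussian_law P Y ->
  \int[P]_w (Y w ^+ 10) = 945 * (\int[P]_w (Y w ^+ 2)) ^+ 5.
Proof. by move=> mY /(gaussian_law_stats mY)[_ [v [_ -> -> _]]]. Qed.

Lemma gaussian_has_moments Y : measurable_fun setT Y -> centered_gaussian_law P Y ->
  has_moments Y.
Proof. by move=> mY /(gaussian_law_stats mY)[]. Qed.

Lemma measurable_affine_comb U Y t : measurable_fun setT U -> measurable_fun setT Y ->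
  measurable_fun setT (fun w => t * U w + Y w).
Proof. by move=> mU mY; apply: measurable_funD => //; exact: measurable_funM. Qed.

(** First of three extractions, for the exponents 4, 2 and 2. It compares coefficients of [t^4],
    where the binomial factor is 210; the remaining exponent 6 belongs to the combination that the
    next rounds split further. *)
Lemma gaussian_moment46 U Y : has_moments U -> has_moments Y ->
  (forall r, centered_gaussian_law P (fun w => r * U w + Y w)) ->
  let A := \int[P]_w (U w ^+ 2) in
  let B := \int[P]_w (U w * Y w) in
  let D := \int[P]_w (Y w ^+ 2) in
  \int[P]_w (U w ^+ 4 * Y w ^+ 6) =
  45 * (A ^+ 2 * D ^+ 3 + 12 * A * B ^+ 2 * D ^+ 2 + 8 * B ^+ 4 * D).
Proof.
move=> mU mY g A B D.
have m1 : has_moments (cst 1) := has_moments_cst 1.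
pose c i := 'C(10, i)%:R * \int[P]_w (1 * (U w ^+ i * Y w ^+ (10 - i))).
(* The coefficients of 945 * (A * t ^+ 2 + 2 * B * t + D) ^+ 5. *)
pose e i := 945 * nth 0 [::
    D ^+ 5;
    10 * B * D ^+ 4;
    5 * A * D ^+ 4 + 40 * B ^+ 2 * D ^+ 3;
    40 * A * B * D ^+ 3 + 80 * B ^+ 3 * D ^+ 2;
    120 * A * B ^+ 2 * D ^+ 2 + 10 * A ^+ 2 * D ^+ 3 + 80 * B ^+ 4 * D;
    160 * A * B ^+ 3 * D + 60 * A ^+ 2 * B * D ^+ 2 + 32 * B ^+ 5;
    80 * A * B ^+ 4 + 120 * A ^+ 2 * B ^+ 2 * D + 10 * A ^+ 3 * D ^+ 2;
    80 * A ^+ 2 * B ^+ 3 + 40 * A ^+ 3 * B * D;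
    40 * A ^+ 3 * B ^+ 2 + 5 * A ^+ 4 * D;
    10 * A ^+ 4 * B;
    A ^+ 5] i.
have := @polynomial_fun_inj 11 c e _ 4%N isT.
rewrite /c /e /= (_ : 'C(10, 4) = 210)%N//.
under eq_Rintegral do rewrite mul1r.
move=> h; suff /h : forall t : R,
    \sum_(i < 11) c i * t ^+ i = \sum_(i < 11) e i * t ^+ i by lra.
move=> t; rewrite -Rintegral_binomial//.
under eq_Rintegral do rewrite mul1r.
rewrite gaussian_moment10//; last by apply: measurable_affine_comb; [case: mU|case: mY].
rewrite Rintegral_square// -/A -/B -/D !big_ord_recr big_ord0 /e /=; ring.
Qed.

Lemma gaussian_moment424 U V Y : has_moments U -> has_moments V -> has_moments Y ->
  (forall r t, centered_gaussian_law P (fun w => r * U w + (t * V w + Y w))) ->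
  let A := \int[P]_w (U w ^+ 2) in
  let B2 := \int[P]_w (V w ^+ 2) in
  let a := \int[P]_w (U w * V w) in
  let b := \int[P]_w (U w * Y w) in
  let u := \int[P]_w (V w * Y w) in
  let v := \int[P]_w (Y w ^+ 2) in
  \int[P]_w (U w ^+ 4 * (V w ^+ 2 * Y w ^+ 4)) =
  3 * (24 * A * B2 * b ^+ 2 * v + 96 * A * a * b * u * v + 12 * A * a ^+ 2 * v
      ^+ 2 + 48 * A * b ^+ 2 * u ^+ 2 + 3 * A ^+ 2 * B2 * v ^+ 2 + 12 * A ^+
      2 * u ^+ 2 * v + 8 * B2 * b ^+ 4 + 64 * a * b ^+ 3 * u + 48 * a ^+ 2 *
      b ^+ 2 * v).
Proof.
move=> mU mV mY g A B2 a b u v.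
have mZ t : has_moments (fun w => t * V w + Y w).
  apply: gaussian_has_moments.
    by apply: measurable_affine_comb; [case: mV|case: mY].
  by have := g 0 t; under eq_fun do rewrite mul0r add0r.
pose c i := 'C(6, i)%:R * \int[P]_w (U w ^+ 4 * (V w ^+ i * Y w ^+ (6 - i))).
(* The coefficients in t of the formula of gaussian_moment46 for t V + Y:
   B becomes a t + b and D becomes B2 t^2 + 2 u t + v. *)
pose e i := 45 * nth 0 [::
    12 * A * b ^+ 2 * v ^+ 2 + A ^+ 2 * v ^+ 3 + 8 * b ^+ 4 * v;
    24 * A * a * b * v ^+ 2 + 48 * A * b ^+ 2 * u * v + 6 * A ^+ 2 * u * v
      ^+ 2 + 32 * a * b ^+ 3 * v + 16 * b ^+ 4 * u;
    24 * A * B2 * b ^+ 2 * v + 96 * A * a * b * u * v + 12 * A * a ^+ 2 * v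
      ^+ 2 + 48 * A * b ^+ 2 * u ^+ 2 + 3 * A ^+ 2 * B2 * v ^+ 2 + 12 * A ^+
      2 * u ^+ 2 * v + 8 * B2 * b ^+ 4 + 64 * a * b ^+ 3 * u + 48 * a ^+ 2 *
      b ^+ 2 * v;
    48 * A * B2 * a * b * v + 48 * A * B2 * b ^+ 2 * u + 96 * A * a * b * u
      ^+ 2 + 48 * A * a ^+ 2 * u * v + 12 * A ^+ 2 * B2 * u * v + 8 * A ^+ 2
      * u ^+ 3 + 32 * B2 * a * b ^+ 3 + 96 * a ^+ 2 * b ^+ 2 * u + 32 * a ^+
      3 * b * v;
    96 * A * B2 * a * b * u + 24 * A * B2 * a ^+ 2 * v + 12 * A * B2 ^+ 2 *
      b ^+ 2 + 48 * A * a ^+ 2 * u ^+ 2 + 12 * A ^+ 2 * B2 * u ^+ 2 + 3 * A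
      ^+ 2 * B2 ^+ 2 * v + 48 * B2 * a ^+ 2 * b ^+ 2 + 64 * a ^+ 3 * b * u +
      8 * a ^+ 4 * v;
    48 * A * B2 * a ^+ 2 * u + 24 * A * B2 ^+ 2 * a * b + 6 * A ^+ 2 * B2 ^+
      2 * u + 32 * B2 * a ^+ 3 * b + 16 * a ^+ 4 * u;
    12 * A * B2 ^+ 2 * a ^+ 2 + A ^+ 2 * B2 ^+ 3 + 8 * B2 * a ^+ 4] i.
have := @polynomial_fun_inj 7 c e _ 2%N isT.
rewrite /c /e /= (_ : 'C(6, 2) = 15)%N//.
move=> h; suff /h : forall t : R,
    \sum_(i < 7) c i * t ^+ i = \sum_(i < 7) e i * t ^+ i by lra.
move=> t; rewrite -Rintegral_binomial//; last exact: has_momentsX.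
rewrite (gaussian_moment46 mU (mZ t) (fun r => g r t)).
rewrite Rintegral_square// Rintegral_linear// -/A -/B2 -/a -/b -/u -/v.
rewrite !big_ord_recr big_ord0 /e /=; ring.
Qed.

Lemma gaussian_moment4222 U V W Y :
  has_moments U -> has_moments V -> has_moments W -> has_moments Y ->
  (forall r t q, centered_gaussian_law P
     (fun w => r * U w + (t * V w + (q * W w + Y w)))) ->
  \int[P]_w (U w ^+ 4 * (V w ^+ 2 * (W w ^+ 2 * Y w ^+ 2))) =
  moment4222 (\int[P]_w (U w ^+ 2)) (\int[P]_w (V w ^+ 2)) (\int[P]_w (W w ^+ 2))
    (\int[P]_w (Y w ^+ 2)) (\int[P]_w (U w * V w)) (\int[P]_w (U w * W w))
    (\int[P]_w (U w * Y w)) (\int[P]_w (V w * W w)) (\int[P]_w (V w * Y w))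
    (\int[P]_w (W w * Y w)).
Proof.
move=> mU mV mW mY g.
set A := \int[P]_w (U w ^+ 2); set B2 := \int[P]_w (V w ^+ 2).
set B3 := \int[P]_w (W w ^+ 2); set B4 := \int[P]_w (Y w ^+ 2).
set a := \int[P]_w (U w * V w); set b := \int[P]_w (U w * W w).
set c := \int[P]_w (U w * Y w); set d' := \int[P]_w (V w * W w).
set e := \int[P]_w (V w * Y w); set f := \int[P]_w (W w * Y w).
have mZ t : has_moments (fun w => t * W w + Y w).
  apply: gaussian_has_moments.
    by apply: measurable_affine_comb; [case: mW|case: mY].
  by have := g 0 0 t; under eq_fun do rewrite !mul0r !add0r.
have mUV : has_moments (fun w => U w ^+ 4 * V w ^+ 2).
  by apply: has_momentsM; exact: has_momentsX.
pose l i := 'C(4, i)%:R * \int[P]_w (U w ^+ 4 * V w ^+ 2 * (W w ^+ i * Y w ^+ (4 - i))).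
(* The coefficients in t of the formula of gaussian_moment424 for t W + Y:
   b, u, v become b t + c, d' t + e and B3 t^2 + 2 f t + B4. *)
pose m i := 3 * nth 0 [::
    24 * A * B2 * B4 * c ^+ 2 + 96 * A * B4 * a * c * e + 12 * A * B4 ^+ 2 *
      a ^+ 2 + 48 * A * c ^+ 2 * e ^+ 2 + 3 * A ^+ 2 * B2 * B4 ^+ 2 + 12 * A
      ^+ 2 * B4 * e ^+ 2 + 8 * B2 * c ^+ 4 + 48 * B4 * a ^+ 2 * c ^+ 2 + 64
      * a * c ^+ 3 * e;
    48 * A * B2 * B4 * b * c + 48 * A * B2 * c ^+ 2 * f + 96 * A * B4 * a *
      b * e + 96 * A * B4 * a * c * d' + 48 * A * B4 * a ^+ 2 * f + 192 * A
      * a * c * e * f + 96 * A * b * c * e ^+ 2 + 96 * A * c ^+ 2 * d' * e +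
      12 * A ^+ 2 * B2 * B4 * f + 24 * A ^+ 2 * B4 * d' * e + 24 * A ^+ 2 *
      e ^+ 2 * f + 32 * B2 * b * c ^+ 3 + 96 * B4 * a ^+ 2 * b * c + 192 * a
      * b * c ^+ 2 * e + 64 * a * c ^+ 3 * d' + 96 * a ^+ 2 * c ^+ 2 * f;
    24 * A * B2 * B3 * c ^+ 2 + 24 * A * B2 * B4 * b ^+ 2 + 96 * A * B2 * b
      * c * f + 24 * A * B3 * B4 * a ^+ 2 + 96 * A * B3 * a * c * e + 96 * A
      * B4 * a * b * d' + 192 * A * a * b * e * f + 192 * A * a * c * d' * f
      + 48 * A * a ^+ 2 * f ^+ 2 + 192 * A * b * c * d' * e + 48 * A * b ^+
      2 * e ^+ 2 + 48 * A * c ^+ 2 * d' ^+ 2 + 6 * A ^+ 2 * B2 * B3 * B4 +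
      12 * A ^+ 2 * B2 * f ^+ 2 + 12 * A ^+ 2 * B3 * e ^+ 2 + 12 * A ^+ 2 *
      B4 * d' ^+ 2 + 48 * A ^+ 2 * d' * e * f + 48 * B2 * b ^+ 2 * c ^+ 2 +
      48 * B3 * a ^+ 2 * c ^+ 2 + 48 * B4 * a ^+ 2 * b ^+ 2 + 192 * a * b *
      c ^+ 2 * d' + 192 * a * b ^+ 2 * c * e + 192 * a ^+ 2 * b * c * f;
    48 * A * B2 * B3 * b * c + 48 * A * B2 * b ^+ 2 * f + 96 * A * B3 * a *
      b * e + 96 * A * B3 * a * c * d' + 48 * A * B3 * a ^+ 2 * f + 192 * A
      * a * b * d' * f + 96 * A * b * c * d' ^+ 2 + 96 * A * b ^+ 2 * d' * e
      + 12 * A ^+ 2 * B2 * B3 * f + 24 * A ^+ 2 * B3 * d' * e + 24 * A ^+ 2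
      * d' ^+ 2 * f + 32 * B2 * b ^+ 3 * c + 96 * B3 * a ^+ 2 * b * c + 192
      * a * b ^+ 2 * c * d' + 64 * a * b ^+ 3 * e + 96 * a ^+ 2 * b ^+ 2 * f;
    24 * A * B2 * B3 * b ^+ 2 + 96 * A * B3 * a * b * d' + 12 * A * B3 ^+ 2
      * a ^+ 2 + 48 * A * b ^+ 2 * d' ^+ 2 + 3 * A ^+ 2 * B2 * B3 ^+ 2 + 12
      * A ^+ 2 * B3 * d' ^+ 2 + 8 * B2 * b ^+ 4 + 48 * B3 * a ^+ 2 * b ^+ 2
      + 64 * a * b ^+ 3 * d'] i.
have := @polynomial_fun_inj 5 l m _ 2%N isT.
rewrite /l /m /= (_ : 'C(4, 2) = 6)%N//.
under [in X in _ -> X]eq_Rintegral do rewrite mulrA.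
move=> h; suff /h : forall t : R,
    \sum_(i < 5) l i * t ^+ i = \sum_(i < 5) m i * t ^+ i.
  by rewrite /moment4222; lra.
move=> t; rewrite -Rintegral_binomial//.
under eq_Rintegral do rewrite -mulrA.
rewrite (gaussian_moment424 mU mV (mZ t) (fun r s => g r s t)).
rewrite Rintegral_square// !Rintegral_linear//.
rewrite -/A -/B2 -/B3 -/B4 -/a -/b -/c -/d' -/e -/f.
rewrite !big_ord_recr big_ord0 /m /=; ring.
Qed.

End moments.

(** * Vanishing of Fourier transforms *)

Section step_polynomial.
Context {R : realType}.
Implicit Types q u x : R.

Lemma bernoulli_ge x m : 0 <= x <= 1 -> 1 - m%:R * x <= (1 - x) ^+ m.
Proof.
move=> /andP[x0 x1]; elim: m => [|m IH]; first by rewrite mul0r subr0 expr0.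
have y0 : 0 <= 1 - x by rewrite subr_ge0.
rewrite exprS; apply: le_trans (ler_wpM2l y0 IH).
rewrite -natr1; have : 0 <= m%:R * (x * x) by rewrite !mulr_ge0.
by lra.
Qed.

(** Each of the [n] terms of [1 + q + ... + q^(n-1)] is at least [q^n], and that sum times [1 - q]
    is [1 - q^n]. *)
Lemma geometric_mul_le q n : 0 <= q <= 1 -> n%:R * q ^+ n * (1 - q) <= 1 - q ^+ n.
Proof.
move=> /andP[q0 q1]; elim: n => [|n IH]; first by rewrite !mul0r expr0 subrr.
have := ler_wpM2l q0 IH; rewrite -natr1 exprS => h.
have qn1 : q * q ^+ n <= 1 by rewrite -exprS exprn_ile1.
have : 0 <= (1 - q) * (1 - q * q ^+ n) by rewrite mulr_ge0// subr_ge0.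
by move: h; rewrite !mulrDr !mulrDl; set z := q ^+ n; lra.
Qed.

(* Tends to the indicator of [1/2, 1] pointwise on [0, 1], because
   4^n n u^(2n) = n (2u)^(2n) tends to 0 for u < 1/2 and is at least n otherwise. *)
Definition step_poly n u : R := 1 - (1 - u ^+ (2 * n)) ^+ (4 ^ n * n).

Lemma step_poly_bound n u : 0 <= u <= 1 -> 0 <= step_poly n u <= 1.
Proof.
move=> /andP[u0 u1]; rewrite /step_poly.
have h0 : 0 <= 1 - u ^+ (2 * n) by rewrite subr_ge0 exprn_ile1.
have h1 : 1 - u ^+ (2 * n) <= 1 by rewrite lerBlDr lerDl exprn_ge0.
by rewrite subr_ge0 exprn_ile1//= lerBlDr lerDl exprn_ge0.
Qed.

(** For [u >= 1/2], [1 - x <= e^(-x)] bounds the distance to 1 by [e^(-n) <= 1 / (n+1)]. For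
    [u < 1/2], Bernoulli bounds the polynomial by [n q^(2n)] with [q = 2 u]; one factor [q^n]
    absorbs [n], since [n q^n <= 1 / (1 - q)], and the other tends to 0. *)
Lemma cvg_step_poly u : 0 <= u <= 1 ->
  step_poly n u @[n --> \oo] --> ((1 / 2 <= u)%R%:R : R).
Proof.
move=> u01; have /andP[u0 u1] := u01.
have mx n : (4 ^ n * n)%:R * u ^+ (2 * n) = n%:R * ((2 * u) ^+ n) ^+ 2.
  rewrite natrM natrX exprM mulrAC -exprMn mulrC; congr (_ * _).
  by rewrite -exprM mulnC exprM; congr (_ ^+ _); ring.
have x01 n : 0 <= u ^+ (2 * n) <= 1 by rewrite exprn_ge0// exprn_ile1.
have [u2|u2] := leP (1 / 2) u.
  rewrite -[X in _ --> X]subr0; apply: cvgB; first exact: cvg_cst.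
  apply: (@squeeze_cvgr _ _ _ _ (cst 0) (fun n => n.+1%:R^-1)).
  - apply: nearW => n; have /andP[x0 x1] := x01 n.
    rewrite /= exprn_ge0 ?subr_ge0//=.
    have e1 : 1 - u ^+ (2 * n) <= expR (- u ^+ (2 * n)) by exact: expR_ge1Dx.
    apply: (@le_trans _ _ (expR (- u ^+ (2 * n)) ^+ (4 ^ n * n))).
      by apply: lerXn2r => //; rewrite nnegrE ?subr_ge0// expR_ge0.
    rewrite -expRM_natl mulrN mx expRN lef_pV2 ?posrE ?expR_gt0//.
    apply: le_trans (expR_ge1Dx _); rewrite -natr1 addrC lerD2l ler_peMr//.
    by rewrite exprn_ege1// exprn_ege1//; lra.
  - exact: cvg_cst.
  - exact: cvg_harmonic.
have q01 : 0 <= 2 * u <= 1 by lra.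
have q1 : 0 < 1 - 2 * u by lra.
apply: (@squeeze_cvgr _ _ _ _ (cst 0) (fun n => (1 - 2 * u)^-1 * (2 * u) ^+ n)).
- apply: nearW => n; have /andP[s0 _] := step_poly_bound n u01.
  rewrite /= s0/= /step_poly.
  have := bernoulli_ge (4 ^ n * n) (x01 n); rewrite mx => b.
  apply: (@le_trans _ _ (n%:R * ((2 * u) ^+ n) ^+ 2)); first by lra.
  rewrite expr2 mulrA ler_wpM2r ?exprn_ge0//; first by case/andP: q01.
  rewrite -[leRHS]mul1r ler_pdivlMr//.
  have := geometric_mul_le n q01; have := exprn_ge0 n (proj1 (andP q01)); lra.
- exact: cvg_cst.
- rewrite -[X in _ --> X](mulr0 (1 - 2 * u)^-1); apply: cvgMr.
  by apply: cvg_expr; rewrite ger0_norm; lra.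
Qed.

End step_polynomial.

Section bounded_integrals.
Context d (T : measurableType d) (R : realType) (P : probability T R).
Implicit Types (f g W : T -> R).

Lemma bounded_integrable f (K : R) : measurable_fun setT f ->
  (forall w, `|f w| <= K) -> P.-integrable setT (EFin \o f).
Proof.
move=> mf fK; have i : P.-integrable setT (EFin \o cst K).
  by apply: finite_measure_integrable_cst.
apply: le_integrable i => //; first exact/measurable_EFinP.
by move=> w _ /=; rewrite lee_fin (le_trans (fK w))// ler_norm.
Qed.

Lemma bounded_cvg_Rintegral (f_ : nat -> T -> R) f (K : R) :
  (forall n, measurable_fun setT (f_ n)) -> (forall n w, `|f_ n w| <= K) ->
  (forall w, f_ n w @[n --> \oo] --> f w) ->
  (forall n, \int[P]_w f_ n w = 0) -> \int[P]_w f w = 0.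
Proof.
move=> mf fK ff f0.
have i : P.-integrable setT (EFin \o cst K) by apply: finite_measure_integrable_cst.
have := @dominated_cvg _ _ _ P setT measurableT (fun n w => (f_ n w)%:E)
  (EFin \o f) (EFin \o cst K).
move=> h; have {}h : (\int[P]_w (f_ n w)%:E @[n --> \oo] --> \int[P]_w (f w)%:E)%E.
  apply: h => //.
  - by move=> n; exact/measurable_EFinP.
  - by move=> w _; apply: cvg_EFin; [exact: nearW|exact: ff].
  - by move=> n w _; rewrite lee_fin.
have e n : (\int[P]_w (f_ n w)%:E = 0%:E)%E.
  rewrite -(f0 n) /Rintegral fineK//; apply: integrable_fin_num => //.
  exact: bounded_integrable (mf n) (fK n).
move: h; under eq_fun do rewrite e.
by rewrite /Rintegral => /(cvg_unique _ (cvg_cst _)) <-.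
Qed.

End bounded_integrals.

(** * From vanishing cosine integrals to Borel sets *)

Section fourier_vanishing.
Context d (T : measurableType d) (R : realType) (P : probability T R).
Variables (Z W : T -> R) (K : R).
Hypotheses (mZ : measurable_fun setT Z) (mW : measurable_fun setT W).
Hypothesis WK : forall w, `|W w| <= K.
Hypothesis cosW : forall t c, \int[P]_w (cos (t * Z w + c) * W w) = 0.

(* As a function of Z - y, the characteristic function of N(0, s^2). *)
Let bump (s y : R) w : R := expR (- (s * (Z w - y)) ^+ 2 / 2).

Let bump01 s y w : 0 <= bump s y w <= 1.
Proof.
rewrite expR_ge0 /= -[leRHS]expR0 ler_expR.
by have := sqr_ge0 (s * (Z w - y)); lra.
Qed.

Let mbump s y : measurable_fun setT (bump s y).
Proof.
apply: measurableT_comp => //; apply: measurable_funM => //.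
apply: measurableT_comp => //; apply: measurable_funX.
apply: measurable_funM => //; exact: measurable_funB.
Qed.

(** Fubini for [P] and a frequency [z] with law [N(0, s^2)]: integrating [cos (z * (Z w - y))] over
    [z] first gives the bump, integrating over [w] first gives 0 by [cosW] with phase
    [- (z * y)]. *)
Let bump_vanish s y : 0 < s -> \int[P]_w (bump s y w * W w) = 0.
Proof.
move=> s0; pose N := normal_prob (0 : R) s.
pose f (wz : T * measurableTypeR R) : \bar R := (cos (wz.2 * (Z wz.1 - y)) * W wz.1)%:E.
have K0 : 0 <= K by apply: le_trans (WK point).
have mcos : measurable_fun setT (cos : R -> R).
  by apply: continuous_measurable_fun; exact: continuous_cos.
have mf : measurable_fun setT f.
  apply/measurable_EFinP; apply: measurable_funM; last exact: measurableT_comp.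
  apply: measurableT_comp => //; apply: measurable_funM => //.
  by apply: measurable_funB => //; exact: measurableT_comp.
have intf : (P \x N)%E.-integrable setT f.
  apply: (@bounded_integrable _ _ R (P \x N)%E _ K); first exact/measurable_EFinP.
  move=> wz; rewrite normrM (le_trans _ (WK wz.1))// ler_piMl//; exact: cos_max.
have := Fubini intf.
rewrite /f /= => FF.
have e1 w : (\int[N]_z (cos (z * (Z w - y)) * W w)%:E = (bump s y w * W w)%:E)%E.
  have i : N.-integrable setT (EFin \o (fun z : R => cos (z * (Z w - y)))).
    apply: (@bounded_integrable _ (measurableTypeR R) R N _ 1).
      by apply: measurableT_comp => //; exact: measurable_funM.
    by move=> z; exact: cos_max.
  under eq_integral do rewrite EFinM.
  rewrite integralZr// EFinM; congr (_ * _)%E.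
  have := normal_cos (Z w - y) 0 s0; rewrite cos0 mul1r /bump => <-.
  rewrite /Rintegral; under [in RHS]eq_integral do rewrite addr0 mulrC.
  by rewrite fineK//; exact: integrable_fin_num.
have e2 z : (\int[P]_w (cos (z * (Z w - y)) * W w)%:E = 0)%E.
  have := cosW z (- (z * y)).
  under eq_Rintegral do rewrite -mulrBr.
  move=> e; rewrite -[RHS]/(0%:E) -e /Rintegral fineK//.
  apply: integrable_fin_num => //; apply: (@bounded_integrable _ _ _ _ _ K).
    apply: measurable_funM => //; apply: measurableT_comp => //.
    by apply: measurable_funM => //; exact: measurable_funB.
  by move=> w; rewrite normrM (le_trans _ (WK w))// ler_piMl//; exact: cos_max.
move: FF; under eq_integral do rewrite e1.
under [in X in _ = X -> _]eq_integral do rewrite e2.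
by rewrite integral0 /Rintegral => ->.
Qed.

(** Closure of bumps under powers lets [bump_vanish] reach every polynomial in a bump without
    constant term. *)
Let bumpX s y w n : bump s y w ^+ n = bump (Num.sqrt n%:R * s) y w.
Proof.
rewrite /bump -expRM_natl; congr expR.
by rewrite -[in RHS](mulrA (Num.sqrt _)) [in RHS]exprMn sqr_sqrtr ?ler0n//; field.
Qed.

Let bumpX_vanish s y n : 0 < s -> (0 < n)%N -> \int[P]_w (bump s y w ^+ n * W w) = 0.
Proof.
move=> s0 n0; under eq_Rintegral do rewrite bumpX.
by apply: bump_vanish; rewrite mulr_gt0// sqrtr_gt0 ltr0n.
Qed.

Let bump_pow_integrable s y e m j :
  P.-integrable setT (EFin \o
    (fun w => bump s y w ^+ j * (1 - bump s y w ^+ e) ^+ m * W w)).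
Proof.
apply: (@bounded_integrable _ _ _ _ _ K).
  apply: measurable_funM => //; apply: measurable_funM; first exact: measurable_funX.
  by apply: measurable_funX; apply: measurable_funB => //; exact: measurable_funX.
move=> w; rewrite normrM (le_trans _ (WK w))// ler_piMl//.
have /andP[b0 b1] := bump01 s y w.
have be0 : 0 <= 1 - bump s y w ^+ e by rewrite subr_ge0 exprn_ile1.
have be1 : 1 - bump s y w ^+ e <= 1 by rewrite lerBlDr lerDl exprn_ge0.
by rewrite ger0_norm ?mulr_ge0 ?exprn_ge0// mulr_ile1 ?exprn_ge0 ?exprn_ile1.
Qed.

(** Peeling off one factor [1 - bump ^+ e] replaces [j] by [j] and [j + e], hence the induction for
    all [j > 0] at once instead of a binomial expansion. *)
Let bump_pow_vanish s y e m j : 0 < s -> (0 < e)%N -> (0 < j)%N ->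
  \int[P]_w (bump s y w ^+ j * (1 - bump s y w ^+ e) ^+ m * W w) = 0.
Proof.
move=> s0 e0; elim: m j => [|m IH] j j0.
  under eq_Rintegral do rewrite expr0 mulr1.
  exact: bumpX_vanish.
transitivity (\int[P]_w (bump s y w ^+ j * (1 - bump s y w ^+ e) ^+ m * W w
   - bump s y w ^+ (j + e) * (1 - bump s y w ^+ e) ^+ m * W w)).
  by apply: eq_Rintegral => w _; rewrite exprS exprD; ring.
by rewrite RintegralB ?IH ?subr0// addn_gt0 j0.
Qed.

(** [step_poly n] has no constant term; telescoping in the outer exponent leaves terms that contain
    a positive power of the bump. *)
Let step_vanish s y n : 0 < s -> \int[P]_w (step_poly n (bump s y w) * W w) = 0.
Proof.
move=> s0; rewrite /step_poly.
case: n => [|n].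
  under eq_Rintegral do rewrite !muln0 !expr0 subrr mul0r.
  by rewrite (Rintegral_cst _ measurableT) mul0r.
elim: (4 ^ n.+1 * n.+1)%N => [|m IH].
  under eq_Rintegral do rewrite expr0 subrr mul0r.
  by rewrite (Rintegral_cst _ measurableT) mul0r.
have e0 : (0 < 2 * n.+1)%N by [].
transitivity (\int[P]_w ((1 - (1 - bump s y w ^+ (2 * n.+1)) ^+ m) * W w +
   bump s y w ^+ (2 * n.+1) * (1 - bump s y w ^+ (2 * n.+1)) ^+ m * W w)).
  by apply: eq_Rintegral => w _; rewrite [in LHS]exprS; ring.
rewrite RintegralD//; first by rewrite IH bump_pow_vanish// addr0.
have := integrable_realB (bump_pow_integrable s y 0 0 0)
  (bump_pow_integrable s y (2 * n.+1) m 0).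
by under eq_fun do rewrite !expr0 mulr1 !mul1r -{1}(mul1r (W _)) -mulrBl.
Qed.

Let vanish (S : set R) := \int[P]_w (\1_S (Z w) * W w) = 0.

Let vanish_limit (S_ : nat -> set R) (S : set R) : (forall n, measurable (S_ n)) ->
  (forall x, \forall n \near \oo, (\1_(S_ n) x : R) = \1_S x) ->
  (forall n, vanish (S_ n)) -> vanish S.
Proof.
move=> mS SS vS; apply: (@bounded_cvg_Rintegral _ _ _ _ _ _ K _ _ _ vS).
- move=> n; apply: measurable_funM => //.
  exact: (measurableT_comp (measurable_indic (mS n)) mZ).
- move=> n w; rewrite normrM (le_trans _ (WK w))// ler_piMl//.
  by rewrite indicE; case: (_ \in _); rewrite ?normr1 ?normr0.
- by move=> w; apply: cvg_near_cst; apply: filterS (SS (Z w)) => n ->.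
Qed.

Let vanish_ball y e : 0 < e -> vanish `[y - e, y + e]%classic.
Proof.
(* Chosen so that [(s * e)^2 / 2 = ln 2]: the bump is at least 1/2, the threshold of [step_poly],
   exactly when [|Z w - y| <= e]. *)
move=> e0; pose s := Num.sqrt (2 * ln 2) / e.
have l2 : 0 < ln 2 :> R by rewrite ln_gt0// ltr1n.
have s0 : 0 < s by rewrite divr_gt0// sqrtr_gt0 mulr_gt0.
apply: (@bounded_cvg_Rintegral _ _ _ _ (fun n w => step_poly n (bump s y w) * W w) _ K).
- move=> n; apply: measurable_funM => //; rewrite /step_poly.
  apply: measurable_funB => //; apply: measurable_funX.
  by apply: measurable_funB => //; exact: measurable_funX.
- move=> n w; rewrite normrM (le_trans _ (WK w))// ler_piMl//.
  by have /andP[h0 h1] := step_poly_bound n (bump01 s y w); rewrite ger0_norm.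
- move=> w; apply: cvgM; last exact: cvg_cst.
  rewrite (_ : \1_ _ _ = (1 / 2 <= bump s y w)%R%:R); first exact: cvg_step_poly.
  rewrite indicE; congr (nat_of_bool _)%:R.
  transitivity (`|Z w - y| <= e); first by rewrite mem_setE in_itv/= distrC ler_distlC.
  rewrite /bump -[1 / 2]lnK ?posrE// ler_expR mul1r lnV ?posrE//.
  have -> : - (s * (Z w - y)) ^+ 2 / 2 = - (ln 2 * (`|Z w - y| / e) ^+ 2).
    rewrite exprMn /s exprMn sqr_sqrtr ?mulr_ge0 ?ltW//.
    rewrite [in RHS]exprMn real_normK ?num_real//.
    by field; exact: lt0r_neq0.
  by rewrite lerN2 ger_pMr// expr_le1 ?divr_ge0 ?(ltW e0)// ler_pdivrMr// mul1r.
- by move=> n; exact: step_vanish.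
Qed.

Let vanish_ray a : vanish `[a, +oo[%classic.
Proof.
apply: (@vanish_limit (fun n => `[a, a + 2 * n.+1%:R]%classic)) => //.
- move=> x; near=> n; rewrite !indicE; congr (nat_of_bool _)%:R.
  apply/idP/idP; rewrite !inE/= !in_itv/=; first by case/andP => ->.
  rewrite andbT => ax; rewrite ax/=.
  rewrite -lerBlDl (@le_trans _ _ n%:R)//.
    by near: n; exact: nbhs_infty_ger.
  by rewrite (@le_trans _ _ n.+1%:R) ?ler_nat// ler_peMl ?ler0n// ler1n.
- move=> n; rewrite (_ : `[_, _]%classic =
    `[(a + n.+1%:R) - n.+1%:R, (a + n.+1%:R) + n.+1%:R]%classic).
    by apply: vanish_ball; rewrite ltr0n.
  by rewrite addrK -addrA -mulr2n mulr_natl.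
Unshelve. all: by end_near. Qed.

Let vanish_setT : vanish setT.
Proof.
apply: (@vanish_limit (fun n => `[- n%:R, +oo[%classic)) => //.
move=> x; near=> n; rewrite !indicE; congr (nat_of_bool _)%:R.
apply/idP/idP; rewrite !inE/= !in_itv/= andbT// => _.
by rewrite lerNl; near: n; exact: nbhs_infty_ger.
Unshelve. all: by end_near. Qed.

Let vanishE (S : set R) : (\int[P]_w (\1_S (Z w) * W w)) = \int[P]_(w in Z @^-1` S) W w.
Proof.
rewrite [RHS]Rintegral_mkcond; apply: eq_Rintegral => w _; rewrite patchE indicE.
rewrite (_ : (w \in Z @^-1` S) = (Z w \in S)); last by apply/idP/idP; rewrite !inE.
by case: ifPn => _; rewrite ?mul1r ?mul0r.
Qed.

Let mpre (S : set R) : measurable S -> measurable (Z @^-1` S).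
Proof. by move=> mS; rewrite -[X in measurable X]setTI; exact: mZ. Qed.

Let intW : P.-integrable setT (EFin \o W) := bounded_integrable P mW WK.

(** Dynkin's argument: the rays [[a, +oo[] are closed under intersection and generate the Borel
    sets, while the sets satisfying [vanish] are stable under complement, by [vanish_setT], and
    under countable disjoint union. *)
Lemma fourier_vanishing (S : set R) : measurable S ->
  \int[P]_w (\1_S (Z w) * W w) = 0.
Proof.
move=> mS; pose G := @RGenCInfty.G R.
have GE : @measurable _ R = <<s G >> by exact: RGenCInfty.measurableE.
apply: (@dynkin_induction _ R G vanish) => //.
- move=> _ _ [a ->] [b ->]; exists (Num.max a b).
  apply/seteqP; split => x /=; rewrite !in_itv/= !andbT ge_max.
    by case=> -> ->.
  by case/andP.
- by move=> _ [a ->]; exact: vanish_ray.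
- move=> A mA; rewrite /vanish !vanishE => A0.
  have := vanish_setT; rewrite /vanish vanishE preimage_setT -(setvU (Z @^-1` A)).
  rewrite Rintegral_setU ?A0 ?addr0//.
  + by apply: measurableC; exact: mpre.
  + exact: mpre.
  + by rewrite setvU.
  + by apply/disj_setPS => x [].
- move=> F mF tF F0; rewrite /vanish vanishE preimage_bigcup /Rintegral.
  have mZF i : measurable (Z @^-1` F i) by exact: mpre.
  have tZF : trivIset setT (fun i => Z @^-1` F i).
    by move=> i j _ _ [w [Fi Fj]]; apply: tF => //; exists (Z w).
  have iZF : P.-integrable (\bigcup_i Z @^-1` F i) (EFin \o W).
    by apply: integrableS intW => //; exact: bigcup_measurable.
  rewrite (integral_bigcup tZF mZF iZF) eseries0// => i _ _.
  have := F0 i; rewrite /vanish vanishE /Rintegral => F0i.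
  rewrite -[LHS]fineK ?F0i//; apply: integrable_fin_num; first exact: mpre.
  exact: integrableS intW.
- by rewrite -GE.
Qed.

End fourier_vanishing.

(** * Independence *)

Section independence.
Context d (T : measurableType d) (R : realType) (P : probability T R).
Implicit Types (V W X Y Z f g : T -> R).

Lemma bounded_integrableM f g (K : R) : P.-integrable setT (EFin \o f) ->
  measurable_fun setT g -> (forall w, `|g w| <= K) ->
  P.-integrable setT (EFin \o (fun w => g w * f w)).
Proof.
move=> fi mg gK; have i : P.-integrable setT (EFin \o (fun w => K * f w)).
  exact: integrable_realZl.
apply: le_integrable i => //.
  apply/measurable_EFinP; apply: measurable_funM => //.
  by apply/measurable_EFinP; exact: measurable_int fi.
move=> w _ /=; rewrite lee_fin !normrM ler_wpM2r// (le_trans (gK w))//.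
exact: ler_norm.
Qed.

Lemma Rintegral_indic Z (B : set R) : measurable_fun setT Z -> measurable B ->
  \int[P]_w \1_B (Z w) = fine (P (Z @^-1` B)).
Proof.
move=> mZ mB; rewrite /Rintegral; congr fine.
have mZB : measurable (Z @^-1` B).
  by rewrite -[X in measurable X]setTI; exact: mZ.
have := integral_indic P measurableT mZB; rewrite setIT => <-.
by apply: eq_integral => w _; rewrite !indicE.
Qed.

Lemma measurable_cosD Y (c : R) : measurable_fun setT Y ->
  measurable_fun setT (fun w => cos (Y w + c)).
Proof.
move=> mY; apply: measurableT_comp; last exact: measurable_funD.
by apply: continuous_measurable_fun; exact: continuous_cos.
Qed.

Lemma cos_integrable Y (c : R) : measurable_fun setT Y ->
  P.-integrable setT (EFin \o (fun w => cos (Y w + c))).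
Proof.
move=> mY; apply: (@bounded_integrable _ _ _ _ _ 1); first exact: measurable_cosD.
by move=> w; exact: cos_max.
Qed.

(* Applied with V a product of indicators of the components already treated and
   Y a linear combination of the components still to come. *)
Lemma independence_step Z Y V (K k : R) (phi : R -> R) (B : set R) c :
  measurable_fun setT Z -> measurable_fun setT Y -> measurable_fun setT V ->
  (forall w, `|V w| <= K) -> (forall t, phi (- t) = phi t) ->
  (forall t c, \int[P]_w cos (t * Z w + c) = phi t * cos c) ->
  (forall t c, \int[P]_w cos (t * Z w + (Y w + c)) =
     phi t * \int[P]_w cos (Y w + c)) ->
  (forall t c, \int[P]_w (V w * cos (t * Z w + (Y w + c))) =
     k * \int[P]_w cos (t * Z w + (Y w + c))) ->
  measurable B ->
  \int[P]_w (V w * \1_B (Z w) * cos (Y w + c)) =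
  k * fine (P (Z @^-1` B)) * \int[P]_w cos (Y w + c).
Proof.
move=> mZ mY mV VK phiN hZ hY hV mB.
pose kc := k * \int[P]_w cos (Y w + c).
(* Subtracting [kc] centers the weight, so that the vanishing of the integral of [\1_B (Z w) * W w]
   is the claimed factorization. *)
pose W w := V w * cos (Y w + c) - kc.
have mcosY c' := @measurable_cosD Y c' mY.
have mW : measurable_fun setT W by apply: measurable_funB => //; exact: measurable_funM.
have iV (g : T -> R) : measurable_fun setT g -> (forall w, `|g w| <= 1) ->
    P.-integrable setT (EFin \o (fun w => V w * g w)).
  move=> mg g1; apply: (@bounded_integrableM _ _ K) => //.
  exact: (@bounded_integrable _ _ _ _ _ 1).
have mtZY t c' : measurable_fun setT (fun w => t * Z w + (Y w + c')).
  by apply: measurable_funD; [exact: measurable_funM|exact: measurable_funD].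
have mcosZY t c' : measurable_fun setT (fun w => cos (t * Z w + (Y w + c'))).
  have := @measurable_cosD _ 0 (mtZY t c').
  by under eq_fun do rewrite addr0.
have icos (g : T -> R) : measurable_fun setT g ->
    P.-integrable setT (EFin \o (fun w => cos (g w))).
  by move=> mg; have := @cos_integrable g 0 mg; under eq_fun do rewrite addr0.
have WK w : `|W w| <= K + `|kc|.
  apply: le_trans (ler_normB _ _) _; rewrite lerD2r normrM.
  by rewrite (le_trans _ (VK w))// ler_piMr//; exact: cos_max.
have cosW t c' : \int[P]_w (cos (t * Z w + c') * W w) = 0.
  (* Product-to-sum puts [t * Z], [Y] and the phases inside one cosine, where [hV] and [hY] apply.
     Evenness of [phi] merges the terms at [t] and [- t]; what remains is [cos (Y + c + c') + cos (Y
     + c - c') = 2 cos c' cos (Y + c)]. *)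
  have e w : cos (t * Z w + c') * W w =
     1 / 2 * (V w * cos (t * Z w + (Y w + (c + c'))) +
       V w * cos (- t * Z w + (Y w + (c - c')))) -
     kc * cos (t * Z w + c').
    have := cosD (Y w + c) (t * Z w + c'); have := cosB (Y w + c) (t * Z w + c').
    rewrite (_ : Y w + c + (t * Z w + c') = t * Z w + (Y w + (c + c'))); last by ring.
    rewrite (_ : Y w + c - (t * Z w + c') = - t * Z w + (Y w + (c - c'))); last by ring.
    by move=> -> ->; rewrite /W; field.
  under eq_Rintegral do rewrite e.
  have i1 := iV _ (mcosZY t (c + c')) (fun w => cos_max _).
  have i2 := iV _ (mcosZY (- t) (c - c')) (fun w => cos_max _).
  have i3 : P.-integrable setT (EFin \o (fun w => cos (t * Z w + c'))).
    by apply: icos; apply: measurable_funD => //; exact: measurable_funM.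
  have i12 := integrable_realD i1 i2.
  rewrite (RintegralB measurableT (integrable_realZl _ i12) (integrable_realZl _ i3)).
  rewrite (RintegralZl _ measurableT i12) (RintegralZl _ measurableT i3).
  rewrite (RintegralD measurableT i1 i2) !hV !hY phiN hZ.
  have -> : phi t * \int[P]_w cos (Y w + (c + c')) =
      phi t * (2 * cos c' * \int[P]_w cos (Y w + c) - \int[P]_w cos (Y w + (c - c'))).
    congr (_ * _); rewrite -RintegralZl//; last exact: cos_integrable.
    rewrite -RintegralB//; last 2 first.
      by apply: integrable_realZl; exact: cos_integrable.
      exact: cos_integrable.
    apply: eq_Rintegral => w _; rewrite !addrA.
    by rewrite (cosD (Y w + c) c') (cosB (Y w + c) c'); ring.
  by rewrite /kc; field.
have := fourier_vanishing mZ mW WK cosW mB.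
have mB1 : measurable_fun setT (fun w => \1_B (Z w) : R).
  exact: (measurableT_comp (measurable_indic mB) mZ).
have B1 w : `|\1_B (Z w) : R| <= 1.
  by rewrite indicE; case: (_ \in _); rewrite ?normr1 ?normr0.
have i1 : P.-integrable setT (EFin \o (fun w => V w * \1_B (Z w) * cos (Y w + c))).
  under eq_fun do rewrite -mulrA; apply: iV; first exact: measurable_funM.
  by move=> w; rewrite normrM mulr_ile1//; exact: cos_max.
have iB : P.-integrable setT (EFin \o (fun w => \1_B (Z w))).
  exact: (@bounded_integrable _ _ _ _ _ 1).
have e w : \1_B (Z w) * W w = V w * \1_B (Z w) * cos (Y w + c) - kc * \1_B (Z w).
  by rewrite /W; ring.
under eq_Rintegral do rewrite e.
rewrite RintegralB//; last exact: integrable_realZl.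
rewrite RintegralZl// Rintegral_indic// => /eqP; rewrite subr_eq0 => /eqP ->.
by rewrite /kc; ring.
Qed.

(** Uncorrelatedness is expressed by a diagonal variance form, which makes the characteristic
    function of every linear combination a product over the components. Four uses of
    [independence_step] then trade the cosines for indicators. *)
Lemma uncorrelated_gaussian_independent X1 X2 X3 X4 :
  measurable_fun setT X1 -> measurable_fun setT X2 ->
  measurable_fun setT X3 -> measurable_fun setT X4 ->
  centered_gaussian_vector4 P X1 X2 X3 X4 ->
  (forall a1 a2 a3 a4, \int[P]_w ((a1 * X1 w + a2 * X2 w + a3 * X3 w + a4 * X4 w) ^+ 2) =
     a1 ^+ 2 * \int[P]_w (X1 w ^+ 2) + a2 ^+ 2 * \int[P]_w (X2 w ^+ 2) +
     a3 ^+ 2 * \int[P]_w (X3 w ^+ 2) + a4 ^+ 2 * \int[P]_w (X4 w ^+ 2)) ->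
  independent4 P X1 X2 X3 X4.
Proof.
move=> m1 m2 m3 m4 g var B1 B2 B3 B4 mB1 mB2 mB3 mB4.
pose phi X (t : R) := expR (- (t ^+ 2 * \int[P]_w (X w ^+ 2)) / 2).
have phiN X t : phi X (- t) = phi X t by rewrite /phi sqrrN.
have phi0 X : phi X 0 = 1 by rewrite /phi expr0n/= mul0r oppr0 mul0r expR0.
have L a1 a2 a3 a4 c :
  \int[P]_w cos (a1 * X1 w + a2 * X2 w + a3 * X3 w + a4 * X4 w + c) =
  phi X1 a1 * (phi X2 a2 * (phi X3 a3 * (phi X4 a4 * cos c))).
  have mL : measurable_fun setT (fun w => a1 * X1 w + a2 * X2 w + a3 * X3 w + a4 * X4 w).
    by do !apply: measurable_funD; exact: measurable_funM.
  have [_ [v [_ <- _ ->]]] := gaussian_law_stats mL (g a1 a2 a3 a4).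
  by rewrite var /phi mulrC !mulrA -!expRD; congr (expR _ * cos c); field.
have E (f h : T -> R) : (forall w, f w = h w) ->
    \int[P]_w cos (f w) = \int[P]_w cos (h w).
  by move=> fh; apply: eq_Rintegral => w _; rewrite fh.
have L1 t c : \int[P]_w cos (t * X1 w + c) = phi X1 t * cos c.
  transitivity (\int[P]_w cos (t * X1 w + 0 * X2 w + 0 * X3 w + 0 * X4 w + c)).
    by apply: E => w; ring.
  by rewrite L !phi0 !mul1r.
have L2 t c : \int[P]_w cos (t * X2 w + c) = phi X2 t * cos c.
  transitivity (\int[P]_w cos (0 * X1 w + t * X2 w + 0 * X3 w + 0 * X4 w + c)).
    by apply: E => w; ring.
  by rewrite L !phi0 !mul1r.
have L3 t c : \int[P]_w cos (t * X3 w + c) = phi X3 t * cos c.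
  transitivity (\int[P]_w cos (0 * X1 w + 0 * X2 w + t * X3 w + 0 * X4 w + c)).
    by apply: E => w; ring.
  by rewrite L !phi0 !mul1r.
have L4 t c : \int[P]_w cos (t * X4 w + c) = phi X4 t * cos c.
  transitivity (\int[P]_w cos (0 * X1 w + 0 * X2 w + 0 * X3 w + t * X4 w + c)).
    by apply: E => w; ring.
  by rewrite L !phi0 !mul1r.
have J1 a2 a3 a4 t c :
    \int[P]_w cos (t * X1 w + ((a2 * X2 w + (a3 * X3 w + a4 * X4 w)) + c)) =
    phi X1 t * \int[P]_w cos ((a2 * X2 w + (a3 * X3 w + a4 * X4 w)) + c).
  transitivity (\int[P]_w cos (t * X1 w + a2 * X2 w + a3 * X3 w + a4 * X4 w + c)).
    by apply: E => w; ring.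
  rewrite L; congr (_ * _).
  transitivity (\int[P]_w cos (0 * X1 w + a2 * X2 w + a3 * X3 w + a4 * X4 w + c)).
    by rewrite L phi0 mul1r.
  by apply: E => w; ring.
have J2 a3 a4 t c : \int[P]_w cos (t * X2 w + ((a3 * X3 w + a4 * X4 w) + c)) =
    phi X2 t * \int[P]_w cos ((a3 * X3 w + a4 * X4 w) + c).
  transitivity (\int[P]_w cos (0 * X1 w + t * X2 w + a3 * X3 w + a4 * X4 w + c)).
    by apply: E => w; ring.
  rewrite L phi0 mul1r; congr (_ * _).
  transitivity (\int[P]_w cos (0 * X1 w + 0 * X2 w + a3 * X3 w + a4 * X4 w + c)).
    by rewrite L !phi0 !mul1r.
  by apply: E => w; ring.
have J3 a4 t c : \int[P]_w cos (t * X3 w + (a4 * X4 w + c)) =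
    phi X3 t * \int[P]_w cos (a4 * X4 w + c).
  rewrite L4.
  transitivity (\int[P]_w cos (0 * X1 w + 0 * X2 w + t * X3 w + a4 * X4 w + c)).
    by apply: E => w; ring.
  by rewrite L !phi0 !mul1r.
have P1 : fine (P setT) = 1 by rewrite probability_setT.
have c0 : \int[P]_w cos (0 + 0) = 1 :> R.
  by rewrite addr0 cos0 (Rintegral_cst _ measurableT) P1 mulr1.
(* The factor 1 gives [i1] the shape [V w * \1_B (Z w)] of [independence_step] with [V = cst 1]; the
   later weights follow the same pattern. *)
pose i1 w : R := 1 * \1_B1 (X1 w); pose i2 w := i1 w * \1_B2 (X2 w).
pose i3 w := i2 w * \1_B3 (X3 w); pose i4 w := i3 w * \1_B4 (X4 w).
have mI X B : measurable_fun setT X -> measurable B ->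
    measurable_fun setT (fun w => \1_B (X w) : R).
  by move=> mX mB; exact: (measurableT_comp (measurable_indic mB) mX).
have mi1 : measurable_fun setT i1 by apply: measurable_funM => //; exact: mI.
have mi2 : measurable_fun setT i2 by apply: measurable_funM => //; exact: mI.
have mi3 : measurable_fun setT i3 by apply: measurable_funM => //; exact: mI.
have I1 (B : set R) x : `|\1_B x : R| <= 1.
  by rewrite indicE; case: (_ \in _); rewrite ?normr1 ?normr0.
have b1 w : `|i1 w| <= 1 by rewrite /i1 mul1r.
have b2 w : `|i2 w| <= 1 by rewrite normrM mulr_ile1.
have b3 w : `|i3 w| <= 1 by rewrite normrM mulr_ile1.
have S1 a2 a3 a4 c : \int[P]_w (i1 w * cos (a2 * X2 w + (a3 * X3 w + a4 * X4 w) + c)) =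
  1 * fine (P (X1 @^-1` B1)) * \int[P]_w cos (a2 * X2 w + (a3 * X3 w + a4 * X4 w) + c).
  apply: (@independence_step X1 _ (cst 1) 1 1 (phi X1)) => //.
  - by do !apply: measurable_funD; exact: measurable_funM.
  - by move=> w; rewrite normr1.
  - by move=> t c'; rewrite mul1r; apply: eq_Rintegral => w _; rewrite mul1r.
have S2 a3 a4 c : \int[P]_w (i2 w * cos (a3 * X3 w + a4 * X4 w + c)) =
  1 * fine (P (X1 @^-1` B1)) * fine (P (X2 @^-1` B2)) *
  \int[P]_w cos (a3 * X3 w + a4 * X4 w + c).
  apply: (@independence_step X2 _ i1 1 _ (phi X2)) => //.
  - by apply: measurable_funD; exact: measurable_funM.
  - move=> t c'; have := S1 t a3 a4 c'.
    by under eq_Rintegral do rewrite -addrA; under [in RHS]eq_Rintegral do rewrite -addrA.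
have S3 a4 c : \int[P]_w (i3 w * cos (a4 * X4 w + c)) =
  1 * fine (P (X1 @^-1` B1)) * fine (P (X2 @^-1` B2)) * fine (P (X3 @^-1` B3)) *
  \int[P]_w cos (a4 * X4 w + c).
  apply: (@independence_step X3 _ i2 1 _ (phi X3)) => //.
  - exact: measurable_funM.
  - move=> t c'; have := S2 t a4 c'.
    by under eq_Rintegral do rewrite -addrA; under [in RHS]eq_Rintegral do rewrite -addrA.
(* No component is left, so [Y] and the phase are 0 and the cosine is 1: the identity becomes the
   product rule for the four events. *)
have S4 : \int[P]_w (i4 w * cos (0 + 0)) =
  1 * fine (P (X1 @^-1` B1)) * fine (P (X2 @^-1` B2)) * fine (P (X3 @^-1` B3)) *
  fine (P (X4 @^-1` B4)) * \int[P]_w cos (0 + 0).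
  apply: (@independence_step X4 (cst 0) i3 1 _ (phi X4)) => //.
  - move=> t c; rewrite /cst; under eq_Rintegral do rewrite add0r.
    by rewrite L4 add0r (Rintegral_cst _ measurableT) P1 mulr1.
  - move=> t c; rewrite /cst; under eq_Rintegral do rewrite add0r.
    by under [in RHS]eq_Rintegral do rewrite add0r; exact: S3.
have mpre X B : measurable_fun setT X -> measurable B -> measurable (X @^-1` B).
  by move=> mX mB; rewrite -[Y in measurable Y]setTI; exact: mX.
have mcap : measurable (X1 @^-1` B1 `&` X2 @^-1` B2 `&` X3 @^-1` B3 `&` X4 @^-1` B4).
  by do !apply: measurableI; exact: mpre.
move: S4; rewrite c0 mulr1 mul1r => S4.
have S5 : fine (P (X1 @^-1` B1 `&` X2 @^-1` B2 `&` X3 @^-1` B3 `&` X4 @^-1` B4)) =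
    \int[P]_w (i4 w * cos (0 + 0)).
  rewrite /Rintegral; congr fine.
  have := integral_indic P measurableT mcap; rewrite setIT => <-.
  apply: eq_integral => w _; rewrite addr0 cos0 mulr1 /i4 /i3 /i2 /i1 mul1r.
  by rewrite !indicI.
rewrite -[LHS]fineK ?fin_num_measure// S5 S4.
by rewrite !EFinM !fineK// fin_num_measure//; exact: mpre.
Qed.

End independence.

(** * Covariances of independent components and of linear combinations *)

Section covariance.
Context d (T : measurableType d) (R : realType) (P : probability T R).
Implicit Types (U V W X Y Z : T -> R).

(** Independence on rectangles identifies the law of the pair with the product of the two laws;
    Fubini then leaves the inner integral [x] times the mean of [Y], which is 0. *)
Lemma independent_covariance X Y :
  measurable_fun setT X -> measurable_fun setT Y ->
  P.-integrable setT (EFin \o (fun w => X w * Y w)) ->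
  P.-integrable setT (EFin \o Y) -> \int[P]_w Y w = 0 ->
  (forall A B : set R, measurable A -> measurable B ->
     P (X @^-1` A `&` Y @^-1` B) = (P (X @^-1` A) * P (Y @^-1` B))%E) ->
  \int[P]_w (X w * Y w) = 0.
Proof.
move=> mX mY iXY iY EY0 ind.
have mXY : measurable_fun setT (fun w => (X w, Y w)) by exact: measurable_fun_pair.
pose X' : {RV P >-> R} := mfun_Sub (mem_set mX : X \in mfun).
pose Y' : {RV P >-> R} := mfun_Sub (mem_set mY : Y \in mfun).
pose XY : {RV P >-> (R * R)%type} :=
  mfun_Sub (mem_set mXY : (fun w => (X w, Y w)) \in mfun).
pose f (z : R * R) : \bar R := (z.1 * z.2)%:E.
have mf : measurable_fun setT f.
  by apply/measurable_EFinP; apply: measurable_funM.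
have prodE (S : set (R * R)) : measurable S ->
    (distribution P X' \x distribution P Y')%E S = distribution P XY S.
  by apply: product_measure_unique => A B mA mB; exact: ind.
have /integrableP[_ absXY] := iXY.
have intf : (distribution P X' \x distribution P Y')%E.-integrable setT f.
  apply/integrableP; split => //.
  rewrite (eq_measure_integral (distribution P XY)); last by move=> S mS _; exact: prodE.
  by rewrite (ge0_integral_distribution XY)//; exact: measurableT_comp.
have := integral12_prod_meas1 intf.
rewrite (eq_measure_integral (distribution P XY)); last by move=> S mS _; exact: prodE.
rewrite (@integral_distribution _ _ _ _ _ P XY f mf iXY) /Rintegral => <-.
have mid : measurable_fun setT (EFin : R -> \bar R) by exact/measurable_EFinP.
have iid : (distribution P Y').-integrable setT (EFin : R -> \bar R).
  by apply: integrable_pushforward.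
have iYe : (\int[distribution P Y']_y y%:E = 0)%E.
  rewrite (@integral_distribution _ _ _ _ _ P Y' EFin mid iY) -[LHS]fineK.
    by rewrite -[fine _]/(\int[P]_w Y w) EY0.
  exact: integrable_fin_num.
rewrite (_ : fubini_F _ _ = cst 0%E); first by rewrite integral0.
apply/funext => x; rewrite /fubini_F /f /=.
under eq_integral do rewrite EFinM.
by rewrite integralZl// iYe mule0.
Qed.

Lemma normal_law_moments Y s : measurable_fun setT Y -> centered_normal_law P Y s ->
  \int[P]_w (Y w ^+ 2) = s ^+ 2 /\ \int[P]_w (Y w ^+ 4) = 3 * s ^+ 4.
Proof.
move=> mY [s0 hY]; have [h2 h4 _] := normal_moment_even s0.
have tr n : \int[P]_w (Y w ^+ n) = \int[normal_prob 0 s]_x (x ^+ n).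
  by apply: (law_transfer mY hY _ (normal_integrableX n s0)).2; exact: measurable_funX.
by rewrite !tr.
Qed.

Lemma normal_law_mean Y s : measurable_fun setT Y -> centered_normal_law P Y s ->
  \int[P]_w Y w = 0.
Proof.
move=> mY [s0 hY]; rewrite -(normal_mean s0).
apply: (law_transfer (f := id) mY hY _ _).2; first exact: measurable_id.
exact: (normal_integrableX 1 s0).
Qed.

(** Serves twice: as the integral of a square it gives the positivity needed by [moment4222_ge] and
    [moment4222_eq], and with zero covariances it is the diagonal form needed for independence. *)
Lemma gaussian_second_moment U V W Y :
  has_moments P U -> has_moments P V -> has_moments P W -> has_moments P Y ->
  (forall r t q u, centered_gaussian_law P
     (fun w => r * U w + t * V w + q * W w + u * Y w)) ->
  forall r t q u, \int[P]_w ((r * U w + t * V w + q * W w + u * Y w) ^+ 2) =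
    \int[P]_w (U w ^+ 2) * r ^+ 2 +
    2 * r * (\int[P]_w (U w * V w) * t + \int[P]_w (U w * W w) * q +
       \int[P]_w (U w * Y w) * u) +
    qform3 (\int[P]_w (V w ^+ 2)) (\int[P]_w (W w ^+ 2)) (\int[P]_w (Y w ^+ 2))
      (\int[P]_w (V w * W w)) (\int[P]_w (V w * Y w)) (\int[P]_w (W w * Y w)) t q u.
Proof.
move=> mU mV mW mY g r t q u.
have mm (Z : T -> R) a : has_moments P Z -> has_moments P (fun w => a * Z w).
  by move=> mZ; exact: (has_momentsM (has_moments_cst P a) mZ).
have m1 : has_moments P (fun w => q * W w + u * Y w).
  apply: gaussian_has_moments.
    by apply: measurable_funD; [case: (mm _ q mW)|case: (mm _ u mY)].
  by have := g 0 0 q u; under eq_fun do rewrite !mul0r !add0r.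
have m2 : has_moments P (fun w => t * V w + (q * W w + u * Y w)).
  apply: gaussian_has_moments.
    by apply: measurable_funD; [case: (mm _ t mV)|case: m1].
  by have := g 0 t q u; under eq_fun do rewrite mul0r add0r -addrA.
under eq_Rintegral do rewrite -!addrA.
rewrite !Rintegral_square//; last exact: mm.
rewrite !Rintegral_linear//; try exact: mm.
have ZZ (Z Z' : T -> R) a : has_moments P Z -> has_moments P Z' ->
    \int[P]_w (Z w * (a * Z' w)) = a * \int[P]_w (Z w * Z' w).
  move=> mZ mZ'; rewrite -RintegralZl//.
    by apply: eq_Rintegral => w _; rewrite mulrCA.
  by apply: has_moments_integrable; exact: has_momentsM.
rewrite /= !ZZ//; last exact: mm.
have -> : \int[P]_w (u * Y w * Y w) = u * \int[P]_w (Y w ^+ 2).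
  rewrite -RintegralZl//; first by apply: eq_Rintegral => w _; rewrite expr2 mulrA.
  exact: mY.2.
rewrite /qform3; ring.
Qed.

End covariance.

Theorem theorem3p2 (d : measure_display) (T : measurableType d) (R : realType)
  (P : probability T R) (X1 X2 X3 X4 : {RV P >-> R}) :
  centered_gaussian_vector4 P X1 X2 X3 X4 ->
  (exists s1, centered_normal_law P X1 s1) ->
  (exists s2, centered_normal_law P X2 s2) ->
  (exists s3, centered_normal_law P X3 s3) ->
  (exists s4, centered_normal_law P X4 s4) ->
  ('E_P[(fun w => X1 w ^+ 4)%R] * 'E_P[(fun w => X2 w ^+ 2)%R] * 'E_P[(fun w => X3 w ^+ 2)%R] * 'E_P[(fun w => X4 w ^+ 2)%R]
     <= 'E_P[(fun w => X1 w ^+ 4 * X2 w ^+ 2 * X3 w ^+ 2 * X4 w ^+ 2)%R])%E /\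
  ('E_P[(fun w => X1 w ^+ 4 * X2 w ^+ 2 * X3 w ^+ 2 * X4 w ^+ 2)%R]
     = 'E_P[(fun w => X1 w ^+ 4)%R] * 'E_P[(fun w => X2 w ^+ 2)%R] * 'E_P[(fun w => X3 w ^+ 2)%R] * 'E_P[(fun w => X4 w ^+ 2)%R]
   <-> independent4 P X1 X2 X3 X4)%E.
Proof.
move=> g [s1 l1] [s2 l2] [s3 l3] [s4 l4].
have mX (X : {RV P >-> R}) : measurable_fun setT X by exact: measurable_funPT.
have m1 := mX X1; have m2 := mX X2; have m3 := mX X3; have m4 := mX X4.
have mom (X : {RV P >-> R}) s : centered_normal_law P X s -> has_moments P X.
  by move=> l; apply: gaussian_has_moments => //; right; exists s.
have h1 := mom _ _ l1; have h2 := mom _ _ l2.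
have h3 := mom _ _ l3; have h4 := mom _ _ l4.
have EE (f : T -> R) : has_moments P f -> ('E_P[f])%E = (\int[P]_w f w)%:E.
  move=> hf; rewrite unlock /Rintegral fineK//; apply: integrable_fin_num => //.
  exact: has_moments_integrable.
have hX (X : {RV P >-> R}) n : has_moments P X -> has_moments P (fun w => X w ^+ n).
  exact: has_momentsX.
have h4222 : has_moments P (fun w => X1 w ^+ 4 * X2 w ^+ 2 * X3 w ^+ 2 * X4 w ^+ 2).
  by do 3 (apply: has_momentsM; last exact: hX); exact: hX.
rewrite !EE//; try exact: hX.
have [v1 f1] := normal_law_moments m1 l1.
have [v2 _] := normal_law_moments m2 l2.
have [v3 _] := normal_law_moments m3 l3.
have [v4 _] := normal_law_moments m4 l4.
have psd := gaussian_second_moment h1 h2 h3 h4 g.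
have M : \int[P]_w (X1 w ^+ 4 * X2 w ^+ 2 * X3 w ^+ 2 * X4 w ^+ 2) =
  moment4222 (s1 ^+ 2) (s2 ^+ 2) (s3 ^+ 2) (s4 ^+ 2) (\int[P]_w (X1 w * X2 w))
   (\int[P]_w (X1 w * X3 w)) (\int[P]_w (X1 w * X4 w)) (\int[P]_w (X2 w * X3 w))
   (\int[P]_w (X2 w * X4 w)) (\int[P]_w (X3 w * X4 w)).
  rewrite -v1 -v2 -v3 -v4 -gaussian_moment4222//.
    by apply: eq_Rintegral => w _; rewrite !mulrA.
  move=> r t q; have := g r t q 1.
  by under eq_fun do rewrite -!addrA mul1r.
rewrite f1 v2 v3 v4 M -!EFinM lee_fin.
have p1 : 0 < s1 by case: l1.
have q2 : 0 < s2 ^+ 2 by rewrite exprn_gt0//; case: l2.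
have q3 : 0 < s3 ^+ 2 by rewrite exprn_gt0//; case: l3.
have q4 : 0 < s4 ^+ 2 by rewrite exprn_gt0//; case: l4.
have psd' w x y z : 0 <= s1 ^+ 2 * w ^+ 2 + 2 * w * (\int[P]_w (X1 w * X2 w) * x +
    \int[P]_w (X1 w * X3 w) * y + \int[P]_w (X1 w * X4 w) * z) +
    qform3 (s2 ^+ 2) (s3 ^+ 2) (s4 ^+ 2) (\int[P]_w (X2 w * X3 w))
     (\int[P]_w (X2 w * X4 w)) (\int[P]_w (X3 w * X4 w)) x y z.
  rewrite -v1 -v2 -v3 -v4 -psd; apply: Rintegral_ge0 => u _; exact: sqr_ge0.
rewrite (_ : 3 * s1 ^+ 4 * s2 ^+ 2 * s3 ^+ 2 * s4 ^+ 2 =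
  3 * s1 ^+ 4 * (s2 ^+ 2 * s3 ^+ 2 * s4 ^+ 2)); last by rewrite !mulrA.
split; first by have := moment4222_ge p1 psd'.
split.
  move=> [] /(moment4222_eq p1 psd' q2 q3 q4) [[c12 c13 c14] [c23 c24 c34]].
  apply: uncorrelated_gaussian_independent => // a1 a2 a3 a4.
  by rewrite psd c12 c13 c14 c23 c24 c34 /qform3; ring.
move=> ind.
have PT : P setT = 1%E := probability_setT P.
have mT : measurable [set: R] := measurableT.
(* Putting [setT] for two of the four events leaves pairwise independence, so all six covariances
   vanish and [moment4222_diag] gives equality. *)
have cov (X Y : {RV P >-> R}) s : has_moments P X -> has_moments P Y ->
    centered_normal_law P Y s -> (forall A B : set R, measurable A -> measurable B ->
     P (X @^-1` A `&` Y @^-1` B) = (P (X @^-1` A) * P (Y @^-1` B))%E) ->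
    \int[P]_w (X w * Y w) = 0.
  move=> hX' hY' l; apply: independent_covariance => //.
  - by apply: has_moments_integrable; exact: has_momentsM.
  - exact: has_moments_integrable.
  - exact: normal_law_mean l.
rewrite (cov X1 X2 s2)//; last first.
  move=> A B mA mB; have := ind A B setT setT mA mB mT mT.
  by rewrite !preimage_setT !setIT PT !mule1.
rewrite (cov X1 X3 s3)//; last first.
  move=> A B mA mB; have := ind A setT B setT mA mT mB mT.
  by rewrite !preimage_setT !setIT PT !mule1.
rewrite (cov X1 X4 s4)//; last first.
  move=> A B mA mB; have := ind A setT setT B mA mT mT mB.
  by rewrite !preimage_setT !setIT PT !mule1.
rewrite (cov X2 X3 s3)//; last first.
  move=> A B mA mB; have := ind setT A B setT mT mA mB mT.
  by rewrite !preimage_setT !setTI !setIT PT !mule1 !mul1e.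
rewrite (cov X2 X4 s4)//; last first.
  move=> A B mA mB; have := ind setT A setT B mT mA mT mB.
  by rewrite !preimage_setT !setTI !setIT PT !mule1 !mul1e.
rewrite (cov X3 X4 s4)//; last first.
  move=> A B mA mB; have := ind setT setT A B mT mT mA mB.
  by rewrite !preimage_setT !setTI PT !mul1e.
by rewrite moment4222_diag !mulrA.
Qed.
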